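(* The set $S_0$ of regular elements in $\mathcal{B}_0$ satisfies the left and right Ore conditions in $\mathcal{B}_0$, and the total ring of fractions $Q_0 := \mathcal{B}_0 S_0^{-1}$ is semisimple artinian.
   Context: Let $\Bbbk$ be a (commutative) field of characteristic $p \neq 2$ ($p=0$ is allowed). The super Jordan plane $\mathcal{B}$ is the associative unital $\Bbbk$-algebra presented by generators $x, y$ with defining relations $x^2 = 0$ and $yz - zy - xz = 0$, where $z = xy + yx$. The relations are homogeneous for $\deg x = \deg y = 1$, so $\mathcal{B}$ is $\mathbb{Z}$-graded; $\mathcal{B}_0$ denotes the even part of $\mathcal{B}$, i.e. the subalgebra which is the sum of the components of even degree. $S_0$ is the set of regular elements of $\mathcal{B}_0$, i.e. of elements of $\mathcal{B}_0$ that are neither left nor right zero divisors in $\mathcal{B}_0$ ($0$ counts as a zero divisor). *)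

(* Defs.v *)
From HB Require Import structures.
From mathcomp Require Import all_boot all_order all_algebra.
From mathcomp Require Import boolp classical_sets.
From mathcomp Require Import finmap monalg.

Set Implicit Arguments.
Unset Strict Implicit.
Unset Printing Implicit Defensive.

Import GRing.Theory.
Local Open Scope ring_scope.
Local Open Scope classical_set_scope.
Local Open Scope quotient_scope.

Section Rings.
Variable R : nzRingType.
Implicit Types (S I : set R) (a s u : R).

Definition left_zero_divisor a := exists2 b, b != 0 & a * b = 0.
Definition right_zero_divisor a := exists2 b, b != 0 & b * a = 0.

Definition regular_elements : set R :=
  [set a | ~ left_zero_divisor a /\ ~ right_zero_divisor a].

Definition right_Ore S :=
  forall a s, S s -> exists b t, S t /\ a * t = s * b.
Definition left_Ore S :=
  forall a s, S s -> exists b t, S t /\ t * a = b * s.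

Definition mutual_inverses s u := s * u = 1 /\ u * s = 1.

Definition two_sided_ideal I :=
  [/\ I 0, forall a b, I a -> I b -> I (a - b)
    & forall a b, I a -> I (b * a) /\ I (a * b)].

Definition right_ideal I :=
  [/\ I 0, forall a b, I a -> I b -> I (a - b)
    & forall a b, I a -> I (a * b)].

Definition minimal_right_ideal I :=
  [/\ right_ideal I, I != [set 0]
    & forall J, right_ideal J -> J `<=` I -> J = [set 0] \/ J = I].

(* Semisimplicity of the regular right module R_R: its submodules are the right
   ideals, and R_R is the sum of the simple ones. *)
Definition right_semisimple :=
  forall a, exists (n : nat) (I : 'I_n -> set R) (c : 'I_n -> R),
    (forall i, minimal_right_ideal (I i) /\ I i (c i)) /\ a = \sum_i c i.

Definition right_artinian :=
  forall I : nat -> set R, (forall n, right_ideal (I n)) ->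
    (forall n, I n.+1 `<=` I n) ->
  exists N, forall n, (N <= n)%N -> I n = I N.

End Rings.

(* Left ideals of R are right ideals of the converse ring R^c. Semisimplicity of
   the regular module is left-right symmetric, so it is required on one side. *)
Definition semisimple_artinian (R : nzRingType) :=
  [/\ right_semisimple R, right_artinian R & right_artinian R^c].

(* Q = R S^-1 through f. The kernel condition makes f injective when S consists
   of regular elements. *)
Record is_right_fractions (R Q : nzRingType) (S : set R)
    (f : {rmorphism R -> Q}) : Prop := IsRightFractions {
  right_fractions_inv : forall s, S s -> exists u, mutual_inverses (f s) u;
  right_fractions_surj : forall q, exists a s u,
    [/\ S s, mutual_inverses (f s) u & q = f a * u];
  right_fractions_ker : forall a, f a = 0 <-> exists2 s, S s & a * s = 0
}.

Definition is_total_fractions (R Q : nzRingType) (f : {rmorphism R -> Q}) :=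
  is_right_fractions (@regular_elements R) f.

Section Quotient.
Variables (k : fieldType) (A : lalgType k) (E : set A).

Definition ideal_gen : {pred A} :=
  fun r => `[< smallest (@two_sided_ideal A) E r >].

Lemma ideal_gen_zmod_closed : zmod_closed ideal_gen.
Proof.
split=> [|a b /asboolP Ia /asboolP Ib].
  by apply/asboolP => I [[I0 _ _] _].
apply/asboolP => I II; case: (II) => -[_ IB _] _.
by apply: IB; [apply: Ia | apply: Ib].
Qed.

Lemma ideal_genMl a b : a \in ideal_gen -> b * a \in ideal_gen.
Proof.
move=> /asboolP Ia; apply/asboolP => I II; case: (II) => -[_ _ IM] _.
exact: (IM a b (Ia I II)).1.
Qed.

Lemma ideal_genMr a b : a \in ideal_gen -> a * b \in ideal_gen.
Proof.
move=> /asboolP Ia; apply/asboolP => I II; case: (II) => -[_ _ IM] _.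
exact: (IM a b (Ia I II)).2.
Qed.

HB.instance Definition _ :=
  GRing.isZmodClosed.Build A ideal_gen ideal_gen_zmod_closed.

(* MathComp has the additive quotient by a zmodClosed predicate, but the ring
   structure only for commutative rings; it is added below. *)
Definition alg_mod := Quotient.quot ideal_gen.
HB.instance Definition _ := Choice.on alg_mod.
HB.instance Definition _ := GRing.Zmodule.on alg_mod.
HB.instance Definition _ := EqQuotient.on alg_mod.

Definition alg_proj (a : A) : alg_mod := \pi_(Quotient.quot ideal_gen) a.

Lemma alg_projP a b : reflect (alg_proj a = alg_proj b) (a - b \in ideal_gen).
Proof. by rewrite Quotient.idealrBE; apply: eqP. Qed.

Lemma alg_projK (u : alg_mod) : alg_proj (repr u) = u.
Proof. exact: reprK. Qed.

Lemma alg_projB : {morph alg_proj : a b / a - b}.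
Proof. exact: raddfB. Qed.

HB.instance Definition _ := GRing.isZmodMorphism.Build A alg_mod alg_proj
  alg_projB.

Lemma alg_projD : {morph alg_proj : a b / a + b}.
Proof. exact: raddfD. Qed.

Definition alg_mod_one : alg_mod := alg_proj 1.
Definition alg_mod_mul (u v : alg_mod) : alg_mod := alg_proj (repr u * repr v).
Definition alg_mod_scale (c : k) (u : alg_mod) : alg_mod := alg_proj (c *: repr u).

Lemma alg_projM a b :
  alg_proj (a * b) = alg_mod_mul (alg_proj a) (alg_proj b).
Proof.
apply/alg_projP; set a' := repr _; set b' := repr _.
have -> : a * b - a' * b' = (a - a') * b + a' * (b - b').
  by rewrite mulrBl mulrBr addrA subrK.
by apply: rpredD; [apply: ideal_genMr | apply: ideal_genMl];
  apply/alg_projP; rewrite alg_projK.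
Qed.

Lemma alg_projZ c a : alg_proj (c *: a) = alg_mod_scale c (alg_proj a).
Proof.
apply/alg_projP; rewrite -scalerBr -[a - _]mul1r scalerAl; apply: ideal_genMl.
by apply/alg_projP; rewrite alg_projK.
Qed.

Lemma alg_mod_ind (P : alg_mod -> Prop) :
  (forall a, P (alg_proj a)) -> forall u, P u.
Proof. by move=> Pa u; rewrite -[u]alg_projK. Qed.

Lemma alg_mod_mulA : associative alg_mod_mul.
Proof.
elim/alg_mod_ind => a; elim/alg_mod_ind => b; elim/alg_mod_ind => c.
by rewrite -!alg_projM mulrA.
Qed.

Lemma alg_mod_mul1l : left_id alg_mod_one alg_mod_mul.
Proof. by elim/alg_mod_ind => a; rewrite -alg_projM mul1r. Qed.

Lemma alg_mod_mul1r : right_id alg_mod_one alg_mod_mul.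
Proof. by elim/alg_mod_ind => a; rewrite -alg_projM mulr1. Qed.

Lemma alg_mod_mulDl : left_distributive alg_mod_mul +%R.
Proof.
elim/alg_mod_ind => a; elim/alg_mod_ind => b; elim/alg_mod_ind => c.
by rewrite -!(alg_projM, alg_projD) mulrDl.
Qed.

Lemma alg_mod_mulDr : right_distributive alg_mod_mul +%R.
Proof.
elim/alg_mod_ind => a; elim/alg_mod_ind => b; elim/alg_mod_ind => c.
by rewrite -!(alg_projM, alg_projD) mulrDr.
Qed.

HB.instance Definition _ := GRing.Zmodule_isPzRing.Build alg_mod
  alg_mod_mulA alg_mod_mul1l alg_mod_mul1r alg_mod_mulDl alg_mod_mulDr.

Lemma alg_mod_scaleA c d u :
  alg_mod_scale c (alg_mod_scale d u) = alg_mod_scale (c * d) u.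
Proof. by elim/alg_mod_ind: u => a; rewrite -!alg_projZ scalerA. Qed.

Lemma alg_mod_scale1 : left_id 1 alg_mod_scale.
Proof. by elim/alg_mod_ind => a; rewrite -alg_projZ scale1r. Qed.

Lemma alg_mod_scaleDr : right_distributive alg_mod_scale +%R.
Proof.
move=> c; elim/alg_mod_ind => a; elim/alg_mod_ind => b.
by rewrite -!(alg_projZ, alg_projD) scalerDr.
Qed.

Lemma alg_mod_scaleDl u : {morph alg_mod_scale^~ u : c d / c + d}.
Proof.
move=> c d; elim/alg_mod_ind: u => a.
by rewrite -!(alg_projZ, alg_projD) scalerDl.
Qed.

HB.instance Definition _ := GRing.Zmodule_isLmodule.Build k alg_mod
  alg_mod_scaleA alg_mod_scale1 alg_mod_scaleDr alg_mod_scaleDl.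

HB.instance Definition _ := GRing.isMonoidMorphism.Build A alg_mod alg_proj
  (erefl, alg_projM).
HB.instance Definition _ := GRing.isScalable.Build k A alg_mod *:%R alg_proj
  alg_projZ.

Lemma alg_mod_scaleAl c (u v : alg_mod) : c *: (u * v) = c *: u * v.
Proof.
change (alg_mod_scale c (alg_mod_mul u v) = alg_mod_mul (alg_mod_scale c u) v).
elim/alg_mod_ind: u => a; elim/alg_mod_ind: v => b.
by rewrite -!(alg_projM, alg_projZ) scalerAl.
Qed.

Lemma alg_mod_scaleAr c (u v : alg_mod) :
  (forall (d : k) (a b : A), d *: (a * b) = a * (d *: b)) ->
  c *: (u * v) = u * (c *: v).
Proof.
move=> AZ.
change (alg_mod_scale c (alg_mod_mul u v) = alg_mod_mul u (alg_mod_scale c v)).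
elim/alg_mod_ind: u => a; elim/alg_mod_ind: v => b.
by rewrite -!(alg_projM, alg_projZ) AZ.
Qed.

Lemma alg_mod_neq0 (S : nzRingType) (f : {rmorphism A -> S}) :
  (forall r, E r -> f r = 0) -> (1 : alg_mod) != 0.
Proof.
move=> fE; apply/eqP; rewrite -(rmorph1 alg_proj) -(rmorph0 alg_proj).
move/alg_projP; rewrite subr0 => /asboolP/(_ [set r | f r = 0]) h.
suff : f 1 = 0 by move/eqP; rewrite rmorph1 oner_eq0.
apply: h; split=> //; split=> [|a b /= a0 b0|a b /= a0]; first exact: rmorph0.
  by rewrite rmorphB a0 b0 subrr.
by rewrite !rmorphM a0 mulr0 mul0r.
Qed.

End Quotient.

Definition sjp_relations (A : nzRingType) (x y : A) : set A :=
  let z := x * y + y * x in [set x ^+ 2; y * z - z * y - x * z].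

Lemma sjp_relations_eval0 (A S : nzRingType) (f : {rmorphism A -> S}) (x y : A) :
  f x = 0 -> f y = 0 -> forall r, sjp_relations x y r -> f r = 0.
Proof.
move=> x0 y0 _ [->|->]; first by rewrite expr2 rmorphM x0 mul0r.
by rewrite !rmorphB !rmorphM x0 y0 !(mul0r, mulr0) !subr0.
Qed.

Section SuperJordanPlane.
Variable k : fieldType.

(* The free algebra k<x, y>: the monoid algebra of the free monoid. *)
Local Notation free2 := {malg k[{fmonom 'I_2}]}.

Definition free_x : free2 := << fmu ord0 >>.
Definition free_y : free2 := << fmu ord_max >>.

(* The super Jordan plane k<x, y> / (x^2, yz - zy - xz), z = xy + yx. *)
Definition sjp := alg_mod (sjp_relations free_x free_y).

HB.instance Definition _ := GRing.PzRing.on sjp.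
HB.instance Definition _ := GRing.Lmodule.on sjp.

Lemma sjp_neq0 : (1 : sjp) != 0.
Proof.
have U0 i : @mcoeff {fmonom 'I_2} k (@mone _) << fmu i >> = 0.
  by rewrite mcoeffU fm1_eq1.
have [aug augU] : exists aug : {rmorphism free2 -> k},
    forall i, aug << fmu i >> = 0.
  by exists (@mcoeff {fmonom 'I_2} k (@mone _)) => i; apply: U0.
apply: (alg_mod_neq0 (f := aug)).
by apply: sjp_relations_eval0; apply: augU.
Qed.

HB.instance Definition _ := GRing.PzSemiRing_isNonZero.Build sjp sjp_neq0.
HB.instance Definition _ := GRing.Lmodule_isLalgebra.Build k sjp
  (@alg_mod_scaleAl _ _ _).

Lemma free2_scalerAr (c : k) (a b : free2) : c *: (a * b) = a * (c *: b).
Proof.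
apply/malgP => m.
rewrite mcoeffZ mcoeffMl (mcoeffMlw _ (fsubset_refl _) (msuppZ_le c b)).
rewrite mulr_sumr; apply: eq_bigr => i _; rewrite mulr_sumr.
by apply: eq_bigr => j _; rewrite mcoeffZ mulrnAr mulrCA.
Qed.

HB.instance Definition _ := GRing.Lalgebra_isAlgebra.Build k sjp
  (fun c u v => alg_mod_scaleAr c u v free2_scalerAr).

(* The homogeneous component of degree n is the image of the span of the words
   of length n. *)
Definition sjp_homog (n : nat) : set sjp :=
  [set b | exists2 a : free2, (forall w, w \in msupp a -> fdeg w = n)
                            & b = alg_proj (sjp_relations free_x free_y) a].

Definition sjp_even : {pred sjp} :=
  fun b => `[< exists (n : nat) (c : nat -> sjp),
    (forall i, sjp_homog i.*2 (c i)) /\ b = \sum_(i < n) c i >].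

Lemma sjp_homogZD n c a b :
  sjp_homog n a -> sjp_homog n b -> sjp_homog n (c *: a + b).
Proof.
move=> [a' ha ->] [b' hb ->]; exists (c *: a' + b'); last first.
  by rewrite linearP.
move=> w /(fsubsetP (msuppD_le _ _)); rewrite inE => /orP[|/hb//].
by move/(fsubsetP (msuppZ_le _ _))/ha.
Qed.

Lemma sjp_homogM m n a b :
  sjp_homog m a -> sjp_homog n b -> sjp_homog (m + n) (a * b).
Proof.
move=> [a' ha ->] [b' hb ->]; exists (a' * b'); last by rewrite rmorphM.
by move=> w /msuppM_le [v [v' [/ha <- /hb <- ->]]]; rewrite fdegM.
Qed.

Lemma sjp_homog0 n : sjp_homog n 0.
Proof. by exists 0; [move=> w; rewrite msupp0 | rewrite rmorph0]. Qed.

Lemma sjp_homog1 : sjp_homog 0 1.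
Proof.
exists 1; last by rewrite rmorph1.
by move=> w /(fsubsetP (msuppC_le _)); rewrite inE => /eqP->; apply: fdeg1.
Qed.

Lemma sjp_homog_even i b : sjp_homog i.*2 b -> b \in sjp_even.
Proof.
move=> hb; apply/asboolP; exists i.+1, (fun j => if j == i then b else 0).
split=> [j|]; first by case: eqP => [->|_] //; apply: sjp_homog0.
rewrite big_ord_recr /= eqxx big1 ?add0r // => j _.
by rewrite ltn_eqF.
Qed.

Lemma sjp_evenD a b : a \in sjp_even -> b \in sjp_even -> a + b \in sjp_even.
Proof.
move=> /asboolP [m [c [hc ->]]] /asboolP [n [d [hd ->]]].
apply/asboolP; exists (m + n).
pose c' i := if (i < m)%N then c i else 0.
pose d' i := if (i < n)%N then d i else 0.
exists (fun i => 1 *: c' i + d' i); split=> [i|].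
  by apply: sjp_homogZD; [rewrite /c' | rewrite /d'];
    case: ifP => // _; apply: sjp_homog0.
rewrite big_split /=; congr (_ + _).
  rewrite (big_ord_widen (m + n) c) ?leq_addr // big_mkcond /=.
  by apply: eq_bigr => i _; rewrite scale1r.
by rewrite (big_ord_widen (m + n) d) ?leq_addl // big_mkcond.
Qed.

Lemma sjp_even0 : 0 \in sjp_even.
Proof. exact/(@sjp_homog_even 0)/sjp_homog0. Qed.

Lemma sjp_even_sum n (F : 'I_n -> sjp) :
  (forall i, F i \in sjp_even) -> \sum_(i < n) F i \in sjp_even.
Proof.
move=> hF; apply: (big_ind (fun b => b \in sjp_even)) => //.
  exact: sjp_even0.
exact: sjp_evenD.
Qed.

Lemma sjp_even_subalg_closed : GRing.subalg_closed sjp_even.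
Proof.
have evenM a b : a \in sjp_even -> b \in sjp_even -> a * b \in sjp_even.
  move=> /asboolP [m [c [hc ->]]] /asboolP [n [d [hd ->]]].
  rewrite mulr_suml; apply: sjp_even_sum => i.
  rewrite mulr_sumr; apply: sjp_even_sum => j.
  by apply: (@sjp_homog_even (i + j)); rewrite doubleD; apply: sjp_homogM.
have even1 : 1 \in sjp_even by exact: (@sjp_homog_even 0 _ sjp_homog1).
have evenZ c a : a \in sjp_even -> c *: a \in sjp_even.
  move=> /asboolP [m [d [hd ->]]]; rewrite scaler_sumr.
  apply: sjp_even_sum => i; apply: (@sjp_homog_even i).
  by rewrite -[_ *: _]addr0; apply: sjp_homogZD => //; apply: sjp_homog0.
by split=> // c a b ha hb; apply: sjp_evenD => //; apply: evenZ.
Qed.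

HB.instance Definition _ :=
  GRing.isSubalgClosed.Build k sjp sjp_even sjp_even_subalg_closed.

Record sjp0 := Sjp0 { sjp0_val : sjp; _ : sjp0_val \in sjp_even }.
HB.instance Definition _ := [isSub for sjp0_val].
HB.instance Definition _ := [Choice of sjp0 by <:].
HB.instance Definition _ := [SubChoice_isSubAlgebra of sjp0 by <:].

End SuperJordanPlane.

(* Main.v *)
Require Import Defs.
From HB Require Import structures.
From mathcomp Require Import all_boot all_order all_algebra.
From mathcomp Require Import boolp classical_sets.
From mathcomp Require Import finmap monalg zify.

(** The even part of the super Jordan plane is an order in a product of two copies
    of a domain.

    Put [z = x y + y x], [u = y^2] and [a = x y]. The defining relations give
    [u z = z u + z^2], so that [z] and [u] generate a Jordan plane [J], and they
    also give [a^2 = z a = a z] and [u a = a u + z a]. Every even element has the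
    form [f + a l] with [f], [l] in [J]. Once [z] is inverted, [a / z] becomes a central
    idempotent; in other words the even part is the subring of [J * J] formed by
    the pairs that agree modulo [z], with [f + a l] corresponding to
    [(f + z l, f)]. The two coordinates, called symbols below, are obtained from a
    representation of the whole algebra by 2 by 2 matrices over [J]
    ([act_relations], [act_symbols], [symbols_inj]).

    The Jordan plane is a domain, by inspection of leading coefficients in [u]
    ([star_eq0]). It is an Ore domain on both sides because its dimension grows
    quadratically: two nonzero right or left ideals that met trivially would
    not fit into the space of elements of bounded degree ([star_right_Ore],
    [star_left_Ore]).

    So the kernels [P1], [P2] of the two symbols are completely prime, they meet in
    zero, the quotients are Ore domains, and [x y], [y x] witness that neither
    kernel contains the other ([sjp0_two_primes]). From this alone everything
    follows. An element is regular exactly when both of its symbols are nonzero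
    ([two_primes_regular]); common multiples in the two quotients glue to common
    multiples in the ring ([two_primes_right_Ore]); and in a ring of fractions a
    right ideal is determined by whether it contains the images of [x y] and
    [y x], whose right ideals are minimal and span
    ([two_primes_semisimple_artinian]). The ring of fractions itself is constructed
    as the ring of germs of right linear maps defined on the right ideals generated by
    a regular element ([Ore_total_fractions]). *)

Set Implicit Arguments.
Unset Strict Implicit.
Unset Printing Implicit Defensive.

Import GRing.Theory.
Local Open Scope ring_scope.
Local Open Scope quotient_scope.

(** * Rings of fractions at the regular elements *)

Section Regular.
Variable R : nzRingType.
Implicit Types a b s t : R.
Local Notation reg := (@regular_elements R).

Lemma regular_mul0r s a : reg s -> s * a = 0 -> a = 0.
Proof.
move=> [Nl _] sa0; apply/eqP; apply: contrapT => /negP a0.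
by apply: Nl; exists a.
Qed.

Lemma regular_mulr0 s a : reg s -> a * s = 0 -> a = 0.
Proof.
move=> [_ Nr] as0; apply/eqP; apply: contrapT => /negP a0.
by apply: Nr; exists a.
Qed.

Lemma regularP s :
  (forall a, s * a = 0 -> a = 0) -> (forall a, a * s = 0 -> a = 0) -> reg s.
Proof.
by move=> sl sr; split=> -[a /eqP a0]; [move/sl/a0 | move/sr/a0].
Qed.

Lemma regular1 : reg 1.
Proof. by apply: regularP => a; rewrite ?mul1r ?mulr1. Qed.

Lemma regularM s t : reg s -> reg t -> reg (s * t).
Proof.
move=> rs rt; apply: regularP => a.
  by rewrite -mulrA => /(regular_mul0r rs)/(regular_mul0r rt).
by rewrite mulrA => /(regular_mulr0 rt)/(regular_mulr0 rs).
Qed.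

Lemma regular_mulI s : reg s -> injective ( *%R s).
Proof.
move=> rs a b /eqP; rewrite -subr_eq0 -mulrBr => /eqP/(regular_mul0r rs)/eqP.
by rewrite subr_eq0 => /eqP.
Qed.

Lemma regular_converse s : @regular_elements R^c s <-> reg s.
Proof. by split=> -[sl sr]; split. Qed.

End Regular.

Section Germs.
Variable R : nzRingType.
Hypothesis R_Ore : right_Ore (@regular_elements R).
Implicit Types (a s r : R).
Local Notation reg := (@regular_elements R).

Lemma right_Ore_common s t : reg s -> reg t ->
  exists c d, reg (s * c) /\ s * c = t * d.
Proof.
move=> rs rt; have [d [c [rc e]]] := R_Ore s rt.
by exists c, d; split=> //; apply: regularM.
Qed.

(** Right linearity on the right ideal [s R]: the values there are [F s * r], so
    additivity on [s R] is included. *)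
Definition near_linear : {pred R -> R} :=
  fun F => `[< exists2 s, reg s & forall r, F (s * r) = F s * r >].

(** A fraction [a / s] is represented by the right linear map [s R -> R] that sends
    [s r] to [a r], extended arbitrarily to [R]. With total functions,
    composition and addition need no bookkeeping of domains, and most ring axioms
    hold before passing to germs. *)
Record partial_map := PartialMap {
  partial_fun :> R -> R;
  _ : partial_fun \in near_linear }.
HB.instance Definition _ := [isSub for partial_fun].
HB.instance Definition _ := [Choice of partial_map by <:].
Implicit Types F G H : partial_map.

Lemma partial_mapP F : exists2 s, reg s & forall r, F (s * r) = F s * r.
Proof. by case: F => F /= /asboolP. Qed.

Lemma near_linearP (F : R -> R) s :
  reg s -> (forall r, F (s * r) = F s * r) -> F \in near_linear.
Proof. by move=> rs Fs; apply/asboolP; exists s. Qed.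

Lemma linear_mulr (F : R -> R) s c : (forall r, F (s * r) = F s * r) ->
  forall r, F (s * c * r) = F (s * c) * r.
Proof. by move=> Fs r; rewrite -mulrA !Fs mulrA. Qed.

Lemma partial_map2 F G : exists s, [/\ reg s,
  forall r, F (s * r) = F s * r & forall r, G (s * r) = G s * r].
Proof.
have [s rs Fs] := partial_mapP F; have [t rt Gt] := partial_mapP G.
have [c [d [rsc e]]] := right_Ore_common rs rt.
by exists (s * c); split=> //; [|rewrite e]; apply: linear_mulr.
Qed.

(** The Ore condition is what makes composition possible: [G] can be restricted to
    a domain that it sends into the domain [t R] of the next map. *)
Lemma comp_domain G t : reg t -> exists s, [/\ reg s,
    forall r, G (s * r) = G s * r & exists d, G s = t * d].
Proof.
move=> rt; have [s rs Gs] := partial_mapP G.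
have [d [c [rc e]]] := R_Ore (G s) rt.
exists (s * c); split; [exact: regularM | exact: linear_mulr |].
by exists d; rewrite Gs.
Qed.

(** The right ideals generated by a regular element play the role of
    neighbourhoods; by the Ore condition two of them contain a third, whence
    transitivity. *)
Definition germ_rel F G :=
  `[< exists2 s, reg s & forall r, F (s * r) = G (s * r) >].

Lemma germ_rel_equiv : equiv_class_of germ_rel.
Proof.
split=> [F|F G|G F H /asboolP[s rs e] /asboolP[t rt e']].
- by apply/asboolP; exists 1; [exact: regular1 |].
- by apply/asboolP/asboolP => -[s rs e]; exists s.
have [c [d [rsc ecd]]] := right_Ore_common rs rt.
apply/asboolP; exists (s * c) => // r.
by rewrite -mulrA e mulrA ecd -mulrA e'.
Qed.
Canonical germ_equiv := EquivRelPack germ_rel_equiv.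

Definition germ := {eq_quot germ_equiv}.
HB.instance Definition _ := Choice.on germ.
HB.instance Definition _ := EqQuotient.on germ.

Definition to_germ F : germ := \pi_germ F.

Lemma germP F G s : reg s -> (forall r, F (s * r) = G (s * r)) ->
  to_germ F = to_germ G.
Proof. by move=> rs e; apply/eqmodP/asboolP; exists s. Qed.

Lemma germ_eq F G : to_germ F = to_germ G ->
  exists2 s, reg s & forall r, F (s * r) = G (s * r).
Proof. by move/eqmodP/asboolP. Qed.

Lemma germ_ind (P : germ -> Prop) : (forall F, P (to_germ F)) -> forall u, P u.
Proof. by move=> PF u; rewrite -[u]reprK; apply: PF. Qed.

Lemma germ_repr F : exists2 s, reg s &
  forall r, (repr (to_germ F) : partial_map) (s * r) = F (s * r).
Proof. by apply: germ_eq; apply: reprK. Qed.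

Fact pmul_subproof a : (fun r => a * r) \in near_linear.
Proof. by apply: (near_linearP (@regular1 R)) => r; rewrite mulrA. Qed.
Definition pmul a := PartialMap (pmul_subproof a).

Fact padd_subproof F G : (fun r => F r + G r) \in near_linear.
Proof.
have [s [rs Fs Gs]] := partial_map2 F G.
by apply: (near_linearP rs) => r; rewrite Fs Gs mulrDl.
Qed.
Definition padd F G := PartialMap (padd_subproof F G).

Fact popp_subproof F : (fun r => - F r) \in near_linear.
Proof.
by have [s rs Fs] := partial_mapP F; apply: (near_linearP rs) => r;
  rewrite Fs mulNr.
Qed.
Definition popp F := PartialMap (popp_subproof F).

Fact pcomp_subproof F G : (fun r => F (G r)) \in near_linear.
Proof.
have [t rt Ft] := partial_mapP F; have [s [rs Gs [d Gd]]] := comp_domain G rt.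
apply: (near_linearP rs) => r; rewrite Gs Gd; exact: linear_mulr.
Qed.
Definition pcomp F G := PartialMap (pcomp_subproof F G).

Definition germ_add (u v : germ) := to_germ (padd (repr u) (repr v)).
Definition germ_opp (u : germ) := to_germ (popp (repr u)).
Definition germ_mul (u v : germ) := to_germ (pcomp (repr u) (repr v)).

Lemma germ_addE F G : germ_add (to_germ F) (to_germ G) = to_germ (padd F G).
Proof.
have [s rs Fs] := germ_repr F; have [t rt Gt] := germ_repr G.
have [c [d [rsc e]]] := right_Ore_common rs rt.
apply: (germP rsc) => r /=.
by rewrite -mulrA Fs mulrA e -[t * d * r]mulrA Gt.
Qed.

Lemma germ_oppE F : germ_opp (to_germ F) = to_germ (popp F).
Proof.
by have [s rs Fs] := germ_repr F; apply: (germP rs) => r /=; rewrite Fs.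
Qed.

Lemma germ_mulE F G : germ_mul (to_germ F) (to_germ G) = to_germ (pcomp F G).
Proof.
have [t rt Ft] := germ_repr F; have [s rs Gs] := germ_repr G.
have [s' [rs' Gs' [d Gd]]] := comp_domain G rt.
have [c [e [rsc esc]]] := right_Ore_common rs rs'.
apply: (germP rsc) => r /=.
by rewrite -mulrA Gs mulrA esc -mulrA Gs' Gd -mulrA Ft.
Qed.

Definition germ0 := to_germ (pmul 0).
Definition germ1 := to_germ (pmul 1).

Fact germ_addA : associative germ_add.
Proof.
elim/germ_ind=> F; elim/germ_ind=> G; elim/germ_ind=> H; rewrite !germ_addE.
by apply: (germP (@regular1 R)) => r /=; rewrite addrA.
Qed.

Fact germ_addC : commutative germ_add.
Proof.
elim/germ_ind=> F; elim/germ_ind=> G; rewrite !germ_addE.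
by apply: (germP (@regular1 R)) => r /=; rewrite addrC.
Qed.

Fact germ_add0 : left_id germ0 germ_add.
Proof.
elim/germ_ind=> F; rewrite germ_addE.
by apply: (germP (@regular1 R)) => r /=; rewrite mul0r add0r.
Qed.

Fact germ_addN : left_inverse germ0 germ_opp germ_add.
Proof.
elim/germ_ind=> F; rewrite germ_oppE germ_addE.
by apply: (germP (@regular1 R)) => r /=; rewrite mul0r addNr.
Qed.

HB.instance Definition _ := GRing.isZmodule.Build germ
  germ_addA germ_addC germ_add0 germ_addN.

Fact germ_mulA : associative germ_mul.
Proof.
elim/germ_ind=> F; elim/germ_ind=> G; elim/germ_ind=> H; rewrite !germ_mulE.
by apply: (germP (@regular1 R)) => r.
Qed.

Fact germ_mul1l : left_id germ1 germ_mul.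
Proof.
elim/germ_ind=> F; rewrite germ_mulE.
by apply: (germP (@regular1 R)) => r /=; rewrite mul1r.
Qed.

Fact germ_mul1r : right_id germ1 germ_mul.
Proof.
elim/germ_ind=> F; rewrite germ_mulE.
by apply: (germP (@regular1 R)) => r /=; rewrite mul1r.
Qed.

Fact germ_mulDl : left_distributive germ_mul germ_add.
Proof.
elim/germ_ind=> F; elim/germ_ind=> G; elim/germ_ind=> H.
rewrite !(germ_mulE, germ_addE).
by apply: (germP (@regular1 R)) => r.
Qed.

(** Additivity of [F] holds only on a domain [t R] of linearity, so [G] and [H] have
    to be moved into [t R] simultaneously. *)
Fact germ_mulDr : right_distributive germ_mul germ_add.
Proof.
elim/germ_ind=> F; elim/germ_ind=> G; elim/germ_ind=> H.
rewrite !(germ_mulE, germ_addE).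
have [t rt Ft] := partial_mapP F.
have [s [rs Gs [d Gd]]] := comp_domain G rt.
have [s' [rs' Hs [d' Hd]]] := comp_domain H rt.
have [c [c' [rsc e]]] := right_Ore_common rs rs'.
apply: (germP rsc) => r /=.
have -> : G (s * c * r) = t * (d * c * r) by rewrite -mulrA Gs Gd -!mulrA.
have -> : H (s * c * r) = t * (d' * c' * r) by rewrite e -mulrA Hs Hd -!mulrA.
by rewrite -mulrDr !Ft mulrDr.
Qed.

HB.instance Definition _ := GRing.Zmodule_isPzRing.Build germ
  germ_mulA germ_mul1l germ_mul1r germ_mulDl germ_mulDr.

Fact germ_neq0 : (1 : germ) != 0.
Proof.
apply/eqP => /germ_eq[s rs /(_ 1)] /=.
rewrite mul1r mul0r mulr1 => s0; case: rs => -[]; exists 1.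
  exact: oner_neq0.
by rewrite s0 mul0r.
Qed.
HB.instance Definition _ := GRing.PzSemiRing_isNonZero.Build germ germ_neq0.

Definition germ_of a : germ := to_germ (pmul a).

Fact germ_of_zmod_morphism : zmod_morphism germ_of.
Proof.
move=> a b; apply/esym/(etrans (y := germ_add (germ_of a) (germ_opp (germ_of b)))) => //.
rewrite germ_oppE germ_addE; apply: (germP (@regular1 R)) => r /=.
by rewrite mulrBl.
Qed.
HB.instance Definition _ :=
  GRing.isZmodMorphism.Build R germ germ_of germ_of_zmod_morphism.

Fact germ_of_monoid_morphism : monoid_morphism germ_of.
Proof.
split=> // a b.
apply/esym/(etrans (y := germ_mul (germ_of a) (germ_of b))) => //.
by rewrite germ_mulE; apply: (germP (@regular1 R)) => r /=; rewrite mulrA.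
Qed.
HB.instance Definition _ :=
  GRing.isMonoidMorphism.Build R germ germ_of germ_of_monoid_morphism.

(** The map [s r |-> r]. It is well defined since [s] is regular; its value outside
    [s R] does not affect the germ. *)
Definition pinv_fun s a := xget 0 [set r | a = s * r]%classic.

Lemma pinv_funK s r : reg s -> pinv_fun s (s * r) = r.
Proof.
move=> rs; rewrite /pinv_fun.
by case: xgetP => [y _ /(regular_mulI rs)//|/(_ r) []].
Qed.

Lemma germ_ofV s : reg s ->
  exists2 F : partial_map, (forall r, F (s * r) = r) &
    mutual_inverses (germ_of s) (to_germ F).
Proof.
move=> rs; have Fl : pinv_fun s \in near_linear.
  have s1 : pinv_fun s s = 1 by have := pinv_funK 1 rs; rewrite mulr1.
  by apply: (near_linearP rs) => r; rewrite pinv_funK // s1 mul1r.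
exists (PartialMap Fl) => [r /=|]; first exact: pinv_funK.
split; apply: (etrans (germ_mulE _ _)); apply: (germP rs) => r /=.
  by rewrite mul1r pinv_funK.
by rewrite mul1r pinv_funK.
Qed.

Lemma germ_total_fractions : is_total_fractions germ_of.
Proof.
split=> [s rs|q|a]; first by have [F _ sF] := germ_ofV rs; exists (to_germ F).
  elim/germ_ind: q => F; have [s rs Fs] := partial_mapP F.
  have [G Gs sG] := germ_ofV rs; exists (F s), s, (to_germ G); split=> //.
  apply/esym/(etrans (germ_mulE _ _)); apply: (germP rs) => r /=.
  by rewrite Gs Fs.
split=> [/germ_eq[s rs /(_ 1)] /=|[s rs as0]].
  by rewrite mulr1 mul0r => as0; exists s.
by apply: (germP rs) => r /=; rewrite mulrA as0 !mul0r.
Qed.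

End Germs.

(** Ore's theorem for the set of regular elements. *)
Theorem Ore_total_fractions (R : nzRingType) :
  right_Ore (@regular_elements R) ->
  exists (Q : nzRingType) (f : {rmorphism R -> Q}), is_total_fractions f.
Proof.
by move=> RO; exists (germ RO), (germ_of RO); exact: germ_total_fractions.
Qed.

(** * Rings with two completely prime ideals of zero intersection *)

Local Open Scope classical_set_scope.

(** Under these hypotheses [R] embeds into the product of the domains [R / P1] and
    [R / P2]; [c1] and [c2] are nonzero elements supported on a single factor. The
    notion is stated through the kernels [P1] and [P2] because in this form it is
    visibly invariant under exchanging the factors and under passing to the
    converse ring, so that each argument below is given once. *)
Record two_primes (R : nzRingType) (P1 P2 : set R) (c1 c2 : R) : Prop :=
  TwoPrimes {
    two_primes_ideal1 : two_sided_ideal P1;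
    two_primes_ideal2 : two_sided_ideal P2;
    two_primes_prime1 : forall a b, P1 (a * b) -> P1 a \/ P1 b;
    two_primes_prime2 : forall a b, P2 (a * b) -> P2 a \/ P2 b;
    two_primes_cap : forall a, P1 a -> P2 a -> a = 0;
    two_primes_c1 : P2 c1 /\ ~ P1 c1;
    two_primes_c2 : P1 c2 /\ ~ P2 c2
  }.

Lemma two_primes_sym (R : nzRingType) (P1 P2 : set R) c1 c2 :
  two_primes P1 P2 c1 c2 -> two_primes P2 P1 c2 c1.
Proof. by case=> *; split=> // a *; auto. Qed.

Lemma two_sided_ideal_converse (R : nzRingType) (P : set R) :
  two_sided_ideal P -> @two_sided_ideal R^c P.
Proof. by case=> P0 PB PM; split=> // a b Pa; have [] := PM a b Pa. Qed.

Lemma two_primes_converse (R : nzRingType) (P1 P2 : set R) c1 c2 :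
  two_primes P1 P2 c1 c2 -> @two_primes R^c P1 P2 c1 c2.
Proof.
case=> i1 i2 p1 p2 cap h1 h2; split=> //; try exact: two_sided_ideal_converse.
  by move=> a b /p1[]; auto.
by move=> a b /p2[]; auto.
Qed.

Section IdealD.
Variables (R : nzRingType) (P : set R).
Hypothesis P_ideal : two_sided_ideal P.

Lemma two_sided_idealDr a b : P b -> P (a + b) -> P a.
Proof.
by case: P_ideal => P0 PB _ Pb Pab; rewrite -[a](addrK b); apply: PB.
Qed.

End IdealD.

(** The right Ore condition for the nonzero elements of [R / P]. *)
Definition right_Ore_mod (R : nzRingType) (P : set R) :=
  forall a s : R, ~ P s -> exists b t, ~ P t /\ P (a * t - s * b).

Section TwoPrimesRing.
Variables (R : nzRingType) (P1 P2 : set R) (c1 c2 : R).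
Hypothesis tp : two_primes P1 P2 c1 c2.
Local Notation reg := (@regular_elements R).

(** An element of [P1] is killed by [c1], whereas an element outside both ideals is
    nonzero in both of the domains into which [R] embeds. *)
Lemma two_primes_regular s : reg s <-> ~ P1 s /\ ~ P2 s.
Proof.
have [[P10 P1B P1M] [P20 P2B P2M] p1 p2 cap [c12 c11] [c21 c22]] := tp.
split=> [rs|[s1 s2]].
  split=> [s1|s2].
    apply: c11; rewrite (regular_mul0r (a := c1) rs) //.
    by apply: cap; [apply: (P1M _ c1 s1).2 | apply: (P2M _ s c12).1].
  apply: c22; rewrite (regular_mul0r (a := c2) rs) //.
  by apply: cap; [apply: (P1M _ s c21).1 | apply: (P2M _ c2 s2).2].
by apply: regularP => a sa0; apply: cap;
  [have [] := p1 _ _ (eq_ind_r P1 P10 sa0)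
  |have [] := p2 _ _ (eq_ind_r P2 P20 sa0)
  |have [] := p1 _ _ (eq_ind_r P1 P10 sa0)
  |have [] := p2 _ _ (eq_ind_r P2 P20 sa0)].
Qed.

Lemma two_primes_mulc12 : c1 * c2 = 0.
Proof.
have [[_ _ P1M] [_ _ P2M] _ _ cap [c12 _] [c21 _]] := tp.
by apply: cap; [apply: (P1M _ c1 c21).1 | apply: (P2M _ c2 c12).2].
Qed.

(** Multiplying the congruence modulo [Pi] by [ci] turns it into an equality in
    [R], and the two equalities can be added: [t1 c1 + t2 c2] lies outside both
    ideals. *)
Lemma two_primes_right_Ore :
  right_Ore_mod P1 -> right_Ore_mod P2 -> right_Ore reg.
Proof.
move=> O1 O2 a s /two_primes_regular[s1 s2].
have [I1 I2 p1 p2 cap [c12 c11] [c21 c22]] := tp.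
have [[P10 P1B P1M] [P20 P2B P2M]] := (I1, I2).
have [b1 [t1 [t1N e1]]] := O1 a s s1; have [b2 [t2 [t2N e2]]] := O2 a s s2.
exists (b1 * c1 + b2 * c2), (t1 * c1 + t2 * c2); split.
  apply/two_primes_regular; split.
    by move/(two_sided_idealDr I1 (P1M _ t2 c21).1)/p1 => -[].
  by rewrite addrC => /(two_sided_idealDr I2 (P2M _ t1 c12).1)/p2 => -[].
have {}e1 : (a * t1 - s * b1) * c1 = 0.
  by apply: cap; [exact: (P1M _ c1 e1).2 | exact: (P2M _ (a * t1 - s * b1) c12).1].
have {}e2 : (a * t2 - s * b2) * c2 = 0.
  by apply: cap; [exact: (P1M _ (a * t2 - s * b2) c21).1 | exact: (P2M _ c2 e2).2].
move/eqP: e1; rewrite mulrBl subr_eq0 -!mulrA => /eqP e1.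
move/eqP: e2; rewrite mulrBl subr_eq0 -!mulrA => /eqP e2.
by rewrite !mulrDr e1 e2.
Qed.

(** Seen from the first factor alone, every nonzero element comes from a regular
    one: if [a] vanishes on the second factor, adding [c2] repairs that. *)
Lemma two_primes_lift a : ~ P1 a -> exists2 s, reg s & c1 * s = c1 * a.
Proof.
have [I1 I2 p1 p2 cap [c12 c11] [c21 c22]] := tp.
move=> a1; have [a2|a2] := pselect (P2 a); last first.
  by exists a => //; apply/two_primes_regular.
exists (a + c2); last by rewrite mulrDr two_primes_mulc12 addr0.
apply/two_primes_regular; split; first by move/(two_sided_idealDr I1 c21).
by rewrite addrC => /(two_sided_idealDr I2 a2).
Qed.

End TwoPrimesRing.

Section RightIdeals.
Variable Q : nzRingType.

Definition principal_right (x : Q) : set Q := [set q | exists r, q = x * r].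

Lemma principal_right_ideal x : right_ideal (principal_right x).
Proof.
split=> [|_ _ [r ->] [r' ->]|_ b [r ->]]; first by exists 0; rewrite mulr0.
  by exists (r - r'); rewrite mulrBr.
by exists (r * b); rewrite mulrA.
Qed.

Lemma right_idealD (I : set Q) : right_ideal I ->
  forall a b, I a -> I b -> I (a + b).
Proof.
case=> I0 IB _ a b Ia Ib; rewrite -[b]opprK -[- b]sub0r.
by apply: (IB) => //; apply: IB.
Qed.

Lemma principal_right_minimal (x : Q) : x != 0 ->
  (forall q, x * q != 0 -> exists r, x * q * r = x) ->
  minimal_right_ideal (principal_right x).
Proof.
move=> x0 xV; split; first exact: principal_right_ideal.
  apply: contra_neq x0 => /seteqP[+ _]; apply.
  by exists 1; rewrite mulr1.
move=> J [J0 JB JM] Jx; have [J_0|] := pselect (forall q, J q -> q = 0).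
  by left; apply/seteqP; split=> [q /J_0|_ ->].
move/existsNP => [q /not_implyP[Jq /eqP q0]]; right; apply/seteqP; split=> //.
have [r eq_q] := Jx _ Jq; rewrite {}eq_q in q0 Jq.
have [r' e] := xV _ q0 => _ [t ->]; rewrite -e -mulrA; exact: JM.
Qed.

End RightIdeals.

Section TwoPrimesFractions1.
Variables (R : nzRingType) (P1 P2 : set R) (c1 c2 : R).
Hypothesis tp : two_primes P1 P2 c1 c2.
Hypothesis R_Ore : right_Ore (@regular_elements R).
Variables (Q : nzRingType) (f : {rmorphism R -> Q}).
Hypothesis fQ : is_total_fractions f.
Local Notation reg := (@regular_elements R).

Lemma total_fractions_inj a : f a = 0 -> a = 0.
Proof. by move/(right_fractions_ker fQ) => [s rs]; exact: regular_mulr0. Qed.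

(** A nonzero multiple of [f c1] is, up to a unit on the right, [f (c1 a)] with [a]
    outside [P1]; by the previous lifting [c1 a = c1 s] with [s] regular, and [f s]
    is invertible. *)
Lemma two_primes_minimal : minimal_right_ideal (principal_right (f c1)).
Proof.
have [I1 I2 p1 p2 cap [c12 c11] [c21 c22]] := tp.
apply: principal_right_minimal => [|q].
  apply/eqP => /total_fractions_inj c10; case: I1 => P10 _ _.
  by apply: c11; rewrite c10.
have [a [s [u [rs [su us] ->]]]] := right_fractions_surj fQ q => qn0.
have a1 : ~ P1 a.
  move=> a1; move: qn0; rewrite mulrA -rmorphM (_ : c1 * a = 0).
    by rewrite rmorph0 mul0r eqxx.
  case: I1 I2 => [_ _ P1M] [_ _ P2M].
  by apply: cap; [apply: (P1M _ c1 a1).1 | apply: (P2M _ a c12).2].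
have [t rt ct] := two_primes_lift tp a1.
have [v [tv vt]] := right_fractions_inv fQ rt.
exists (f s * v).
rewrite !mulrA -(mulrA _ u) us mulr1 -rmorphM -ct rmorphM.
by rewrite -mulrA tv mulr1.
Qed.

(** Apply the Ore condition to [c1] and the regular element [a c1 + c2], which gives
    [c1 t = (a c1 + c2) b]. Reading this modulo [P2] yields [c2 b = 0], hence
    [c1 t = a c1 b] and [f c1] is a right multiple of [f a]. *)
Lemma right_ideal_c1 (J : set Q) a u : right_ideal J -> ~ P1 a ->
  J (f a * u) -> (exists s, u * s = 1) -> J (f c1).
Proof.
have [I1 I2 p1 p2 cap [c12 c11] [c21 c22]] := tp.
have [[_ _ P1M] [_ P2B P2M]] := (I1, I2).
move=> [_ _ JM] a1 Jau [s us].
have rg : reg (a * c1 + c2).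
  apply/(two_primes_regular tp); split.
    by move/(two_sided_idealDr I1 c21)/p1 => -[].
  by rewrite addrC => /(two_sided_idealDr I2 (P2M _ a c12).1).
have [b [t [rt ct]]] := R_Ore c1 rg.
have b2 : P2 b.
  have := (P2M _ t c12).2; rewrite ct => /p2[|//].
  by rewrite addrC => /(two_sided_idealDr I2 (P2M _ a c12).1).
have cb : c2 * b = 0.
  by apply: cap; [apply: (P1M _ b c21).2 | apply: (P2M _ c2 b2).1].
have [v [tv vt]] := right_fractions_inv fQ rt.
have -> : f c1 = f a * u * (s * f c1 * f b * v).
  rewrite !mulrA -(mulrA _ u) us mulr1 -!rmorphM.
  have -> : a * c1 * b = c1 * t by rewrite ct mulrDl cb addr0.
  by rewrite rmorphM -mulrA tv mulr1.
exact: JM.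
Qed.

End TwoPrimesFractions1.

Lemma decreasing_prop_stable (P : nat -> Prop) : (forall n, P n.+1 -> P n) ->
  exists N, forall n, (N <= n)%N -> P n <-> P N.
Proof.
move=> Pdec; have PN m n : (m <= n)%N -> P n -> P m.
  move/subnK<-; elim: (n - m)%N => // d IH; rewrite addSn => /Pdec; exact: IH.
have [allP|] := pselect (forall n, P n); first by exists 0%N.
move/existsNP => [N NP]; exists N => n Nn; split=> [/(PN _ _ Nn)//|].
by move/NP.
Qed.

Section TwoPrimesFractions.
Variables (R : nzRingType) (P1 P2 : set R) (c1 c2 : R).
Hypothesis tp : two_primes P1 P2 c1 c2.
Hypothesis R_Ore : right_Ore (@regular_elements R).
Variables (Q : nzRingType) (f : {rmorphism R -> Q}).
Hypothesis fQ : is_total_fractions f.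
Local Notation reg := (@regular_elements R).

Lemma regular_c1c2 : reg (c1 + c2).
Proof.
have [I1 I2 p1 p2 cap [c12 c11] [c21 c22]] := tp.
apply/(two_primes_regular tp); split; first by move/(two_sided_idealDr I1 c21).
by rewrite addrC => /(two_sided_idealDr I2 c12).
Qed.

(** [f (c1 + c2)] is a unit, so the ring is the sum of the minimal right ideals
    generated by [f c1] and [f c2]. *)
Lemma two_primes_semisimple : right_semisimple Q.
Proof.
move=> q; have [u [su us]] := right_fractions_inv fQ regular_c1c2.
pose c (i : 'I_2) := if i == ord0 then f c1 else f c2.
exists 2%N, (fun i => principal_right (c i)), (fun i => c i * (u * q)).
split=> [i|]; last first.
  by rewrite !big_ord_recl big_ord0 addr0 -mulrDl -rmorphD mulrA su mul1r.
split; last by exists (u * q).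
rewrite /c; case: eqP => _.
  exact: (two_primes_minimal tp fQ).
exact: (two_primes_minimal (two_primes_sym tp) fQ).
Qed.

(** A right ideal is determined by which of [f c1], [f c2] it contains. There are
    thus at most four right ideals, which is stronger than the descending chain
    condition. *)
Lemma right_ideal_sub (J K : set Q) : right_ideal J -> right_ideal K ->
  (K (f c1) -> J (f c1)) -> (K (f c2) -> J (f c2)) -> K `<=` J.
Proof.
move=> rJ rK K1 K2 q; have [a [s [u [rs [su us] ->]]]] := right_fractions_surj fQ q.
move=> Kq; have [[_ _ JM] JD] := (rJ, right_idealD rJ).
have [I1 I2 p1 p2 cap [c12 c11] [c21 c22]] := tp.
have [[P10 _ P1M] [P20 _ P2M]] := (I1, I2).
have [c1N c2N] := (two_primes_regular tp _).1 regular_c1c2.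
(* The equality a t = (c1 + c2) b splits f a into two parts. The part with
   c1 b vanishes when a lies in P1; otherwise f c1 lies in K, hence in J. *)
have [b [t [rt ct]]] := R_Ore a regular_c1c2.
have [v [tv vt]] := right_fractions_inv fQ rt.
have uV : exists s, u * s = 1 by exists (f s).
have J1 : J (f (c1 * b)).
  have [a1|a1] := pselect (P1 a).
    suff -> : c1 * b = 0 by rewrite rmorph0; case: rJ.
    apply: cap; last exact: (P2M _ b c12).2.
    apply: (P1M _ c1 _).1; have := (P1M _ t a1).2.
    by rewrite ct => /p1[].
  rewrite rmorphM; apply/JM/K1; exact: (right_ideal_c1 tp R_Ore fQ rK a1 Kq uV).
have J2 : J (f (c2 * b)).
  have [a2|a2] := pselect (P2 a).
    suff -> : c2 * b = 0 by rewrite rmorph0; case: rJ.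
    apply: cap; first exact: (P1M _ b c21).2.
    apply: (P2M _ c2 _).1; have := (P2M _ t a2).2.
    by rewrite ct => /p2[].
  rewrite rmorphM; apply/JM/K2.
  exact: (right_ideal_c1 (two_primes_sym tp) R_Ore fQ rK a2 Kq uV).
have -> : f a = (f (c1 * b) + f (c2 * b)) * v.
  by rewrite -rmorphD -mulrDl -ct rmorphM -mulrA tv mulr1.
by rewrite -mulrA; apply: JM; apply: JD.
Qed.

Lemma two_primes_artinian : right_artinian Q.
Proof.
move=> I rI Idec.
have [N1 h1] := decreasing_prop_stable (fun n => Idec n (f c1)).
have [N2 h2] := decreasing_prop_stable (fun n => Idec n (f c2)).
exists (maxn N1 N2) => n; rewrite geq_max => /andP[n1 n2].
have m1 := h1 _ (leq_maxl N1 N2); have m2 := h2 _ (leq_maxr N1 N2).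
apply/seteqP; split; apply: right_ideal_sub => //.
- by move/(h1 _ n1).1/m1.2.
- by move/(h2 _ n2).1/m2.2.
- by move/m1.1/(h1 _ n1).2.
- by move/m2.1/(h2 _ n2).2.
Qed.

End TwoPrimesFractions.

Section Converse.
Variables (R Q : nzRingType) (f : {rmorphism R -> Q}).

Definition converse_fun : R^c -> Q^c := f.

Fact converse_zmod_morphism : zmod_morphism converse_fun.
Proof. exact: (rmorphB f). Qed.
HB.instance Definition _ :=
  GRing.isZmodMorphism.Build R^c Q^c converse_fun converse_zmod_morphism.

Fact converse_monoid_morphism : monoid_morphism converse_fun.
Proof. by split=> [|a b]; [exact: (rmorph1 f) | exact: (rmorphM f)]. Qed.
HB.instance Definition _ :=
  GRing.isMonoidMorphism.Build R^c Q^c converse_fun converse_monoid_morphism.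

(** By the left Ore condition right fractions [a s^-1] are also left fractions
    [t^-1 b]; this transfers the descending chain condition from right ideals to
    left ideals. *)
Lemma total_fractions_converse : left_Ore (@regular_elements R) ->
  is_total_fractions f -> is_total_fractions converse_fun.
Proof.
move=> LO fQ; split=> [s /regular_converse rs|q|a].
- by have [u [su us]] := right_fractions_inv fQ rs; exists u.
- have [a [s [u [rs [su us] ->]]]] := right_fractions_surj fQ q.
  have [b [t [rt e]]] := LO a s rs.
  have [v [tv vt]] := right_fractions_inv fQ rt.
  exists b, t, v; split=> //; first exact/regular_converse.
  change (f a * u = v * f b).
  rewrite -[f a]mul1r -vt -(mulrA v) -rmorphM e rmorphM -!mulrA su mulr1.
  by [].
split=> [/(total_fractions_inj fQ)->|].
  by exists 1; [exact/regular_converse/regular1 | exact: mul0r].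
move=> [s /regular_converse rs sa0].
by rewrite (regular_mul0r rs sa0 : a = 0); exact: (rmorph0 f).
Qed.

End Converse.

Theorem two_primes_semisimple_artinian (R : nzRingType) (P1 P2 : set R) c1 c2
    (Q : nzRingType) (f : {rmorphism R -> Q}) :
  two_primes P1 P2 c1 c2 ->
  right_Ore (@regular_elements R) -> left_Ore (@regular_elements R) ->
  is_total_fractions f -> semisimple_artinian Q.
Proof.
move=> tp RO LO fQ; split; first exact: (two_primes_semisimple tp fQ).
  exact: (two_primes_artinian tp RO fQ).
apply: (two_primes_artinian (two_primes_converse tp) _
  (total_fractions_converse LO fQ)).
move=> a s /regular_converse rs; have [b [t [rt e]]] := LO a s rs.
by exists b, t; split=> //; apply/regular_converse.
Qed.

Lemma two_primes_left_Ore (R : nzRingType) (P1 P2 : set R) c1 c2 :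
  two_primes P1 P2 c1 c2 ->
  @right_Ore_mod R^c P1 -> @right_Ore_mod R^c P2 ->
  left_Ore (@regular_elements R).
Proof.
move=> tp O1 O2 a s rs.
have RO := two_primes_right_Ore (two_primes_converse tp) O1 O2.
have [b [t [rt e]]] := RO a s ((regular_converse s).2 rs).
by exists b, t; split=> //; apply/regular_converse.
Qed.

(** * The Jordan plane *)

Section JordanPlane.
Variable k : fieldType.
Local Notation C := {poly {poly k}}.
Implicit Types (p q : {poly k}) (f g h s t : C) (c : k).

(** The derivation [z^2 d/dz] of [k[z]]: the commutation rule [u z = z u + z^2] says
    that the commutator with [u] acts on polynomials in [z] in this way. *)
Definition jder p : {poly k} := 'X^2 * p^`().

Fact jder_is_zmod_morphism : zmod_morphism jder.
Proof. by move=> p q; rewrite /jder derivB mulrBr. Qed.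
HB.instance Definition _ :=
  GRing.isZmodMorphism.Build {poly k} {poly k} jder jder_is_zmod_morphism.

Lemma jderM p q : jder (p * q) = p * jder q + jder p * q.
Proof. by rewrite /jder derivM mulrDr addrC mulrCA !mulrA. Qed.

Lemma jderC c : jder c%:P = 0.
Proof. by rewrite /jder derivC mulr0. Qed.

Lemma jderX : jder 'X = 'X^2.
Proof. by rewrite /jder derivX mulr1. Qed.

(** In [{poly {poly k}}] the inner variable stands for [z] and the outer one for
    [u], and a polynomial stands for the corresponding combination of the ordered
    monomials [z^i u^j]. This operator is left multiplication by [u] in that
    notation. *)
Definition uop f : C := 'X * f + map_poly jder f.

Fact uop_is_zmod_morphism : zmod_morphism uop.
Proof. by move=> f g; rewrite /uop mulrBr raddfB addrACA opprD. Qed.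
HB.instance Definition _ :=
  GRing.isZmodMorphism.Build C C uop uop_is_zmod_morphism.

Lemma coef_uop f i :
  (uop f)`_i = (if i == 0%N then 0 else f`_i.-1) + jder f`_i.
Proof. by rewrite coefD coefXM coef_map. Qed.

Lemma uopZ p f : uop (p *: f) = p *: uop f + jder p *: f.
Proof.
apply/polyP => i; rewrite [RHS]coefD !coefZ !coef_uop !coefZ jderM mulrDr addrA.
by case: eqP; rewrite ?mulr0.
Qed.

Lemma uopXn n : uop 'X^n = 'X^(n.+1).
Proof.
apply/polyP => i; rewrite coef_uop !coefXn.
have -> b : jder (b%:R : {poly k}) = 0 by rewrite -polyC_natr jderC.
by case: i => [|i] /=; rewrite addr0.
Qed.

Lemma iter_uop1 n : iter n uop 1 = 'X^n.
Proof. by elim: n => [|n IH] /=; rewrite ?expr0 // IH uopXn. Qed.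

Lemma iter_uopZ c n f : iter n uop (c%:P *: f) = c%:P *: iter n uop f.
Proof. by elim: n => //= n ->; rewrite uopZ jderC scale0r addr0. Qed.

Lemma iter_uopB n : zmod_morphism (iter n uop).
Proof. by move=> f g; elim: n => //= n ->; rewrite raddfB. Qed.

(** The product of the Jordan plane [k<z, u | u z - z u = z^2>] transported to
    ordered monomials: [f] is evaluated at the operators of left multiplication by
    [z] and [u] and applied to [h]. *)
Definition star f h : C := \sum_(j < size f) f`_j *: iter j uop h.

Lemma star_widen n f h : (size f <= n)%N ->
  star f h = \sum_(j < n) f`_j *: iter j uop h.
Proof.
move=> fn; rewrite /star (big_ord_widen n (fun j => f`_j *: iter j uop h)) //.
rewrite [RHS](bigID (fun j : 'I_n => (j < size f)%N)) /= [X in _ + X]big1 ?addr0 //.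
by move=> j; rewrite -leqNgt => /leq_sizeP-> //; rewrite scale0r.
Qed.

Fact star_is_zmod_morphism f : zmod_morphism (star f).
Proof.
move=> g h; rewrite /star -sumrB; apply: eq_bigr => j _.
by rewrite iter_uopB scalerBr.
Qed.
HB.instance Definition _ f :=
  GRing.isZmodMorphism.Build C C (star f) (@star_is_zmod_morphism f).

Fact star_zmod_morphism_l h : zmod_morphism (star^~ h).
Proof.
move=> f g; set n := maxn (size f) (size g).
rewrite !(@star_widen n) ?leq_maxl ?leq_maxr //; last first.
  by rewrite (leq_trans (size_polyD _ _)) // size_polyN.
by rewrite -sumrB; apply: eq_bigr => j _; rewrite coefB scalerBl.
Qed.
Definition star_r h f := star f h.
HB.instance Definition _ h :=
  GRing.isZmodMorphism.Build C C (star_r h) (@star_zmod_morphism_l h).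

Lemma starDl f g h : star (f + g) h = star f h + star g h.
Proof. exact: (raddfD (star_r h)). Qed.

Lemma star0l h : star 0 h = 0.
Proof. exact: (raddf0 (star_r h)). Qed.

Lemma starZl p f h : star (p *: f) h = p *: star f h.
Proof.
rewrite (@star_widen (size f)) ?size_scale_leq // /star scaler_sumr.
by apply: eq_bigr => j _; rewrite coefZ scalerA.
Qed.

Lemma starZr c f h : star f (c%:P *: h) = c%:P *: star f h.
Proof.
rewrite /star scaler_sumr; apply: eq_bigr => j _.
by rewrite iter_uopZ !scalerA mulrC.
Qed.

Lemma star1r f : star f 1 = f.
Proof.
rewrite -[RHS]coefK poly_def; apply: eq_bigr => j _.
by rewrite iter_uop1.
Qed.

Lemma size_uop f : (size (uop f) <= (size f).+1)%N.
Proof.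
apply/leq_sizeP => i fi; rewrite coef_uop !nth_default ?raddf0 ?if_same ?addr0 //.
  exact: ltnW.
by case: i fi.
Qed.

Lemma size_iter_uop n f : (size (iter n uop f) <= size f + n)%N.
Proof.
elim: n => [|n IH]; rewrite ?addn0 // addnS /=.
exact: leq_trans (size_uop _) _.
Qed.

Lemma coef_iter_uop n f : (iter n uop f)`_((size f).-1 + n) = lead_coef f.
Proof.
elim: n => [|n IH]; rewrite ?addn0 // addnS iterS coef_uop /= IH.
rewrite nth_default ?raddf0 ?addr0 //.
apply: leq_trans (size_iter_uop _ _) _.
by case: (size f) => // m; rewrite addSn.
Qed.

(** Applying the operator of [u] raises the degree in [u] by exactly one and keeps
    the leading coefficient, so leading coefficients multiply. *)
Lemma star_eq0 f h : star f h = 0 -> f = 0 \/ h = 0.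
Proof.
have [->|f0] := eqVneq f 0; first by left.
have [->|h0] := eqVneq h 0; first by right.
move/(congr1 (fun g : C => g`_((size h).-1 + (size f).-1))); rewrite coef0.
rewrite /star coef_sum -(prednK (_ : 0 < size f)%N) ?size_poly_gt0 //.
rewrite big_ord_recr /= big1 ?add0r => [|j _]; rewrite coefZ.
  rewrite coef_iter_uop => /eqP.
  by rewrite mulf_eq0 !lead_coef_eq0 (negPf f0) (negPf h0).
have sj : (size (iter j uop h) <= (size h).-1 + (size f).-1)%N.
  apply: leq_trans (size_iter_uop _ _) _.
  by rewrite -{1}(prednK (_ : 0 < size h)%N) ?size_poly_gt0 // addSn ltn_add2l.
by move/leq_sizeP: sj => -> //; rewrite mulr0.
Qed.

(** The span of the [n * m] monomials [z^i u^j] with [i < n] and [j < m]. *)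
Definition box n m f := (size f <= m)%N /\ forall i, (size (f`_i)%R <= n)%N.

Lemma box_widen n m n' m' f : (n <= n')%N -> (m <= m')%N ->
  box n m f -> box n' m' f.
Proof.
move=> nn mm [fm fn]; split=> [|i]; first exact: leq_trans mm.
exact: leq_trans nn.
Qed.

Lemma box0 n m : box n m 0.
Proof. by split=> [|i]; rewrite ?coef0 size_poly0. Qed.

Lemma boxD n m f g : box n m f -> box n m g -> box n m (f + g).
Proof.
move=> [fm fn] [gm gn]; split=> [|i].
  by rewrite (leq_trans (size_polyD _ _)) // geq_max fm.
by rewrite coefD (leq_trans (size_polyD _ _)) // geq_max fn gn.
Qed.

Lemma boxZ a n m p f : (size p <= a)%N -> box n m f -> box (a + n) m (p *: f).
Proof.
move=> pa [fm fn]; split=> [|i]; first exact: leq_trans (size_scale_leq _ _) fm.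
rewrite coefZ (leq_trans (size_polyMleq _ _)) // (leq_trans (leq_pred _)) //.
exact: leq_add.
Qed.

Lemma size_jder p : (size (jder p) <= (size p).+1)%N.
Proof.
rewrite /jder; have [->|p0] := eqVneq p^`() 0; first by rewrite mulr0 size_poly0.
rewrite size_monicM ?monicXn // size_polyXn /= add2n ltnS.
by rewrite lt_size_deriv //; apply: contraNneq p0 => ->; rewrite deriv0.
Qed.

Lemma box_uop n m f : box n m f -> box n.+1 m.+1 (uop f).
Proof.
move=> [fm fn]; split=> [|i]; first exact: leq_trans (size_uop f) _.
rewrite coef_uop (leq_trans (size_polyD _ _)) // geq_max; apply/andP; split.
  by case: eqP => _; rewrite ?size_poly0 // ltnW // ltnS.
by rewrite (leq_trans (size_jder _)) // ltnS.
Qed.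

Lemma box_iter_uop j n m f : box n m f -> box (n + j) (m + j) (iter j uop f).
Proof.
by elim: j => [|j IH] fb; rewrite ?addn0 // !addnS; apply/box_uop/IH.
Qed.

(** Moving [u] past a polynomial in [z] may raise its degree by one, whence the
    summand [b] in the bound on the degree in [z]. *)
Lemma box_star a b n m f h :
  box a b f -> box n m h -> box (a + b + n) (b + m) (star f h).
Proof.
move=> [fb fa] hb; rewrite /star; apply: (big_ind (box (a + b + n) (b + m))).
- exact: box0.
- exact: boxD.
move=> j _; have jb : (j <= b)%N by apply: leq_trans fb; apply: ltnW.
rewrite -addnA; apply: boxZ => //.
by apply: box_widen (box_iter_uop j hb); rewrite addnC leq_add2r.
Qed.

Lemma box_exists f : exists D, box D D f.
Proof.
pose D := (size f + \sum_(i < size f) size (f`_i)%R)%N; exists D.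
split=> [|i]; first exact: leq_addr.
have [fi|fi] := leqP (size f) i; first by rewrite nth_default // size_poly0.
apply: leq_trans (leq_addl _ _).
by rewrite (bigD1 (Ordinal fi)) //= leq_addr.
Qed.

Lemma box_dependent (I : finType) (e : I -> C) n m :
  (forall i, box n m (e i)) -> (n * m < #|I|)%N ->
  exists v : I -> k, (exists i, v i != 0) /\ \sum_i (v i)%:P *: e i = 0.
Proof.
move=> be cardI.
pose A := \matrix_(i < #|I|) mxvec (\matrix_(a < n, b < m) (e (enum_val i))`_b`_a).
have : kermx A != 0.
  rewrite -mxrank_eq0 mxrank_ker subn_eq0 -ltnNge.
  exact: leq_ltn_trans (rank_leq_col A) cardI.
case/rowV0Pn => v /sub_kermxP vA /eqP v0.
exists (fun i => v 0 (enum_rank i)); split.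
  apply: contrapT => /forallNP nv; apply: v0; apply/rowP => i; rewrite mxE.
  by have /negP/negbNE/eqP := nv (enum_val i); rewrite enum_valK.
apply/polyP => b; apply/polyP => a; rewrite !coef0 coef_sum coef_sum.
have zero i : (e i)`_b`_a = 0 \/ (a < n)%N /\ (b < m)%N.
  have [em en] := be i.
  have [mb|bm] := leqP m b.
    by left; rewrite (nth_default _ (leq_trans em mb)) coef0.
  have [na|an] := leqP n a; last by right.
  by left; rewrite nth_default // (leq_trans (en b)).
have [/andP[an bm]|nab] := boolP ((a < n) && (b < m))%N; last first.
  rewrite big1 // => i _; rewrite coefZ coefCM.
  by case: (zero i) => [->|[an bm]]; [rewrite mulr0 | rewrite an bm in nab].
move/rowP/(_ (mxvec_index (Ordinal an) (Ordinal bm))): vA.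
rewrite !mxE => vAi; rewrite -[RHS]vAi (reindex (@enum_val I predT)) /=; last first.
  exact: (onW_bij _ (@enum_val_bij I)).
apply: eq_bigr => i _; rewrite coefZ coefCM enum_valK; congr (_ * _).
by rewrite mxE mxvecE mxE.
Qed.

Definition monomial n m (i : 'I_n * 'I_m) : C := 'X^(i.1) *: 'X^(i.2).

Lemma box_monomial n m (i : 'I_n * 'I_m) : box n m (monomial i).
Proof.
split=> [|j].
  by rewrite (leq_trans (size_scale_leq _ _)) // size_polyXn.
rewrite coefZ coefXn; case: eqP => _.
  by rewrite mulr1 size_polyXn.
by rewrite mulr0 size_poly0.
Qed.

Lemma coef_monomial_sum n m (v : 'I_n * 'I_m -> k) (i : 'I_n * 'I_m) :
  (\sum_j (v j)%:P *: monomial j)`_(i.2)`_(i.1) = v i.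
Proof.
rewrite !coef_sum (bigD1 i) //= big1 => [|j ji].
  by rewrite !coefZ !coefXn eqxx mulr1 coefCM coefXn eqxx mulr1 addr0.
rewrite !coefZ coefXn coefCM; case: eqP => [e2|_]; last by rewrite mulr0 coef0 mulr0.
rewrite mulr1 coefXn; case: eqP => [e1|_]; last by rewrite mulr0.
case/eqP: ji; apply/eqP; case: i j e1 e2 => [i1 i2] [j1 j2] /= e1 e2.
by rewrite xpair_eqE -!val_eqE /= e1 e2 !eqxx.
Qed.

(** Dimension count: [F] and [G] together send a space of dimension [2 n m] to one of
    dimension [n' m'], so [F t - G b] vanishes for some nontrivial pair, and
    injectivity of [G] excludes [t = 0]. *)
Lemma common_value (F G : {additive C -> C}) n m n' m' :
  (forall c h, F (c%:P *: h) = c%:P *: F h) ->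
  (forall c h, G (c%:P *: h) = c%:P *: G h) ->
  (forall h, G h = 0 -> h = 0) ->
  (forall h, box n m h -> box n' m' (F h)) ->
  (forall h, box n m h -> box n' m' (G h)) ->
  (n' * m' < 2 * (n * m))%N ->
  exists t b, t != 0 /\ F t = G b.
Proof.
move=> FZ GZ Ginj Fb Gb card.
pose e (i : ('I_n * 'I_m) + ('I_n * 'I_m)) :=
  match i with inl j => F (monomial j) | inr j => G (monomial j) end.
have [|/=|v [[i vi] sv]] := @box_dependent _ e n' m'.
- by case=> j; [apply/Fb/box_monomial | apply/Gb/box_monomial].
- by rewrite card_sum card_prod !card_ord addnn -mul2n.
pose t := \sum_j (v (inl j))%:P *: monomial j.
pose b := \sum_j (v (inr j))%:P *: monomial j.
have FG : F t = G (- b).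
  move: sv; rewrite big_sumType /= => /eqP; rewrite addr_eq0 raddfN => /eqP sv.
  rewrite /t raddf_sum; under eq_bigr do rewrite FZ; rewrite sv; congr (- _).
  by rewrite /b raddf_sum; apply: eq_bigr => j _; rewrite GZ.
exists t, (- b); split=> //; apply/eqP => t0.
have b0 : b = 0.
  by apply: Ginj; apply/eqP; rewrite -oppr_eq0 -raddfN -FG t0 raddf0.
case: i vi => j; rewrite -?(coef_monomial_sum (fun j => v (inl j)))
  -?(coef_monomial_sum (fun j => v (inr j))).
  by rewrite -/t t0 !coef0 eqxx.
by rewrite -/b b0 !coef0 eqxx.
Qed.

Lemma box_exists2 f s : exists2 D, (0 < D)%N & box D D f /\ box D D s.
Proof.
have [D1 b1] := box_exists f; have [D2 b2] := box_exists s.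
exists (D1 + D2).+1 => //; split; first apply: box_widen b1; try apply: box_widen b2;
  by rewrite ltnW // ltnS ?leq_addr ?leq_addl.
Qed.

(** The Jordan plane has quadratic growth, so the images of a large box under
    multiplication by [f] and by [s] must meet. The elongated box with [10 D]
    powers of [z] and [2 D] powers of [u] serves on both sides: its two copies have
    total dimension [40 D^2], against [36 D^2] for the target here and [39 D^2] in
    the left version, where reordering costs more. *)
Lemma star_right_Ore f s : s != 0 -> exists t b, t != 0 /\ star f t = star s b.
Proof.
move=> /eqP s0; have [D D0 [fb sb]] := box_exists2 f s.
apply: (@common_value (star f) (star s) (10 * D) (2 * D)
  (D + D + 10 * D) (D + 2 * D)).
- by move=> c h; apply: starZr.
- by move=> c h; apply: starZr.
- by move=> h /star_eq0[].
- by move=> h; apply: box_star.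
- by move=> h; apply: box_star.
nia.
Qed.

Lemma star_left_Ore f s : s != 0 -> exists t b, t != 0 /\ star t f = star b s.
Proof.
move=> /eqP s0; have [D D0 [fb sb]] := box_exists2 f s.
apply: (@common_value (star_r f) (star_r s) (10 * D) (2 * D)
  (10 * D + 2 * D + D) (2 * D + D)).
- by move=> c h; apply: starZl.
- by move=> c h; apply: starZl.
- by move=> h /star_eq0[].
- by move=> h hb; apply: box_star.
- by move=> h hb; apply: box_star.
nia.
Qed.

End JordanPlane.

(** * Ideals cut out by a map to the Jordan plane *)

Section Symbols.
Variables (k : fieldType) (R : nzRingType).
Local Notation C := {poly {poly k}}.
Variable sigma : {additive R -> C}.
Hypothesis sigmaM : forall a b, sigma (a * b) = star (sigma a) (sigma b).
Hypothesis sigma_surj : forall f, exists a, sigma a = f.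

Definition symbol_ker : set R := [set a | sigma a = 0]%classic.

Lemma symbol_ker_ideal : two_sided_ideal symbol_ker.
Proof.
rewrite /symbol_ker; split=> [|a b /= a0 b0|a b /= a0]; first exact: raddf0.
  by rewrite raddfB a0 b0 subrr.
by rewrite !sigmaM a0 star0l raddf0.
Qed.

Lemma symbol_ker_prime a b :
  symbol_ker (a * b) -> symbol_ker a \/ symbol_ker b.
Proof. by rewrite /symbol_ker /= sigmaM => /star_eq0. Qed.

Lemma symbol_right_Ore : right_Ore_mod symbol_ker.
Proof.
move=> a s /eqP s0; have [t [b [/eqP t0 e]]] := star_right_Ore (sigma a) s0.
have [T tT] := sigma_surj t; have [B bB] := sigma_surj b.
exists B, T; rewrite /symbol_ker /= tT; split=> //.
by rewrite raddfB !sigmaM tT bB e subrr.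
Qed.

Lemma symbol_left_Ore : @right_Ore_mod R^c symbol_ker.
Proof.
move=> a s /eqP s0; have [t [b [/eqP t0 e]]] := star_left_Ore (sigma a) s0.
have [T tT] := sigma_surj t; have [B bB] := sigma_surj b.
exists B, T; rewrite /symbol_ker /= tT; split=> //.
change (sigma (T * (a : R) - B * (s : R)) = 0).
by rewrite raddfB !sigmaM tT bB e subrr.
Qed.

End Symbols.

(** * A faithful representation of the super Jordan plane *)

Section Representation.
Variable k : fieldType.
Local Notation C := {poly {poly k}}.
Local Notation V := (C * C)%type.
Local Notation free2 := {malg k[{fmonom 'I_2}]}.
Implicit Types (g h : free2) (v w : V) (c : k).

(** These are the matrices [x = z E12] and [y = u E12 + E21] over the Jordan plane,
    acting on pairs of its elements. They are odd, so even elements act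
    diagonally; [x y] acts by [z] on the first component and by zero on the second
    one, while [y^2] and [x y + y x] act by [u] and [z] on both. *)
Definition act_x v : V := ('X *: v.2, 0).
Definition act_y v : V := (uop v.2, v.1).
Definition act_gen (i : 'I_2) := if i == ord0 then act_x else act_y.
Definition act_word (s : seq 'I_2) v := foldr act_gen v s.
Definition free_act v g : V :=
  \sum_(m <- msupp g) (g@_m)%:P *: act_word m v.

Lemma act_gen_linear i c v w :
  act_gen i (c%:P *: v + w) = c%:P *: act_gen i v + act_gen i w.
Proof.
rewrite /act_gen; case: eqP => _; rewrite /act_x /act_y.
  by congr (_, _); rewrite /= ?scaler0 ?addr0 // scalerDr !scalerA mulrC.
by congr (_, _); rewrite /= raddfD /= uopZ jderC scale0r addr0.
Qed.

Lemma act_word_linear s c v w :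
  act_word s (c%:P *: v + w) = c%:P *: act_word s v + act_word s w.
Proof. by elim: s => //= i s ->; exact: act_gen_linear. Qed.

Lemma act_word0 s : act_word s 0 = 0.
Proof.
have /eqP := act_word_linear s 1 0 0.
by rewrite !scale1r addr0 addrC -subr_eq subrr => /eqP.
Qed.

Lemma act_wordZ s c v : act_word s (c%:P *: v) = c%:P *: act_word s v.
Proof. by have := act_word_linear s c v 0; rewrite act_word0 !addr0. Qed.

Lemma act_wordD s v w : act_word s (v + w) = act_word s v + act_word s w.
Proof. by have := act_word_linear s 1 v w; rewrite !scale1r. Qed.

Lemma free_act_widen (d : {fset {fmonom 'I_2}}) v g : (msupp g `<=` d)%fset ->
  free_act v g = \sum_(m <- d) (g@_m)%:P *: act_word m v.
Proof.
move=> le; rewrite [LHS](big_fset_incl _ le) => //= m _ /mcoeff_outdom ->.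
by rewrite scale0r.
Qed.

Fact free_act_zmod_morphism v : zmod_morphism (free_act v).
Proof.
move=> g h; set d := (msupp g `|` msupp h)%fset.
rewrite !(@free_act_widen d) ?fsubsetUl ?fsubsetUr ?msuppB_le //.
by rewrite -sumrB; apply: eq_bigr => m _; rewrite mcoeffB raddfB scalerBl.
Qed.
HB.instance Definition _ v :=
  GRing.isZmodMorphism.Build free2 V (free_act v) (free_act_zmod_morphism v).

Lemma free_actD v g h : free_act v (g + h) = free_act v g + free_act v h.
Proof. exact: raddfD. Qed.

Lemma free_actB v g h : free_act v (g - h) = free_act v g - free_act v h.
Proof. exact: raddfB. Qed.

Lemma free_actU v c m : free_act v << c *g m >> = c%:P *: act_word m v.
Proof. by rewrite (free_act_widen _ msuppU_le) big_seq_fset1 mcoeffUU. Qed.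

Lemma free_act0 g : free_act 0 g = 0.
Proof. by rewrite /free_act big1 // => m _; rewrite act_word0 scaler0. Qed.

Lemma free_actM v g h : free_act v (g * h) = free_act (free_act v h) g.
Proof.
rewrite malgME raddf_sum /= [RHS]/free_act; apply: eq_bigr => m _.
rewrite raddf_sum /= [in RHS]/free_act.
rewrite (big_morph _ (act_wordD m) (act_word0 m)) scaler_sumr.
apply: eq_bigr => n _.
by rewrite act_wordZ free_actU scalerA polyCM fmM /act_word foldr_cat.
Qed.

Lemma free_act_x v : free_act v (free_x k) = act_x v.
Proof. by rewrite free_actU fmU scale1r. Qed.

Lemma free_act_y v : free_act v (free_y k) = act_y v.
Proof. by rewrite free_actU fmU scale1r. Qed.

Lemma act_xE (f h : C) : act_x (f, h) = ('X *: h, 0).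
Proof. by []. Qed.

Lemma act_yE (f h : C) : act_y (f, h) = (uop h, f).
Proof. by []. Qed.

Lemma pair_addE (f h f' h' : C) : (f, h) + (f', h') = (f + f', h + h') :> V.
Proof. by []. Qed.

Lemma pair_scaleE (p : {poly k}) (f h : C) : p *: ((f, h) : V) = (p *: f, p *: h).
Proof. by []. Qed.

(** Stated for an arbitrary ring acting on pairs, so as to apply to the free algebra
    and to its quotient alike. *)
Section Relations.
Variables (A : nzRingType) (act : V -> A -> V) (x y : A).
Hypothesis actD : forall v a b, act v (a + b) = act v a + act v b.
Hypothesis actB : forall v a b, act v (a - b) = act v a - act v b.
Hypothesis actM : forall v a b, act v (a * b) = act (act v b) a.
Hypothesis actx : forall v, act v x = act_x v.
Hypothesis acty : forall v, act v y = act_y v.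

Lemma act_z v : act v (x * y + y * x) = 'X *: v.
Proof.
rewrite actD !actM !(actx, acty).
case: v => v1 v2; rewrite !(act_xE, act_yE) pair_addE pair_scaleE.
by rewrite raddf0 addr0 add0r.
Qed.

Lemma act_relations r v : sjp_relations x y r -> act v r = 0.
Proof.
case=> ->; first by rewrite expr2 actM !actx /act_x scaler0.
rewrite !actB (actM v y) (actM v _ y) (actM v x) !act_z !(actx, acty).
case: v => v1 v2; rewrite !(act_xE, act_yE, pair_scaleE).
rewrite uopZ jderX.
congr (_, _); last first.
  by change ('X *: v1 - 'X *: v1 - 0 = 0); rewrite subr0 subrr.
change ('X *: uop v2 + 'X^2 *: v2 - 'X *: uop v2 - 'X *: ('X *: v2) = 0).
by rewrite scalerA -expr2 addrAC addrK subrr.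
Qed.

End Relations.

Local Notation proj := (alg_proj (sjp_relations (free_x k) (free_y k))).

Definition sjp_act v (b : sjp k) :=
  free_act v (repr (b : alg_mod (sjp_relations (free_x k) (free_y k)))).

Lemma sjp_act_proj g v : sjp_act v (proj g) = free_act v g.
Proof.
apply/eqP; rewrite -subr_eq0 -[X in X == _]raddfB; apply/eqP.
have /alg_projP/asboolP h : proj (repr (proj g)) = proj g by rewrite alg_projK.
apply: (h [set r | forall v, free_act v r = 0]%classic) => //.
split=> [|r Er w]; last first.
  exact: (act_relations free_actD free_actB free_actM free_act_x free_act_y w Er).
split=> [w|a b a0 b0 w|a b a0]; first exact: raddf0.
  by change (free_act w (a - b) = 0); rewrite free_actB a0 b0 subrr.
split=> w; first by rewrite /= (free_actM w b a) a0 free_act0.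
by rewrite /= (free_actM w a b) a0.
Qed.

End Representation.

(** * Normal forms and symbols of even elements *)

Section Presentation.
Variables (k : fieldType) (A : algType k) (x y z u : A).
Local Notation C := {poly {poly k}}.
Implicit Types (p q : {poly k}) (f g h l : C).
Hypothesis zE : z = x * y + y * x.
Hypothesis uE : u = y * y.
Hypothesis relA : forall r, sjp_relations x y r -> r = 0.

Let xx : x * x = 0.
Proof. by apply: relA; left. Qed.

Let yz : y * z = z * y + x * z.
Proof.
by apply/eqP; rewrite -subr_eq0 opprD addrA zE; apply/eqP/relA; right.
Qed.

Let yx : y * x = z - x * y.
Proof. by rewrite zE [_ + y * x]addrC addrK. Qed.

Let xyz : x * y * z = x * z * y.
Proof. by rewrite -mulrA yz mulrDr !mulrA xx mul0r addr0. Qed.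

Let uz : u * z = z * u + z * z.
Proof.
rewrite uE -mulrA yz mulrDr !mulrA yz yx mulrDl mulrBl xyz.
by rewrite addrA addrAC addrK.
Qed.

Local Notation phi := (horner_alg z).

(** The value at [z], [u] of a polynomial read with powers of [z] on the left: the
    map from ordered monomials to the algebra. *)
Definition normal_form f : A := \sum_(j < size f) phi f`_j * u ^+ j.
Local Notation nu := normal_form.

Lemma normal_form_widen n f : (size f <= n)%N ->
  nu f = \sum_(j < n) phi f`_j * u ^+ j.
Proof.
move=> fn; rewrite /nu (big_ord_widen n (fun j => phi f`_j * u ^+ j)) //.
rewrite [RHS](bigID (fun j : 'I_n => (j < size f)%N)) /= [X in _ + X]big1 ?addr0 //.
by move=> j; rewrite -leqNgt => /leq_sizeP-> //; rewrite raddf0 mul0r.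
Qed.

Lemma normal_formD f g : nu (f + g) = nu f + nu g.
Proof.
set n := maxn (size f) (size g).
rewrite !(@normal_form_widen n) ?leq_maxl ?leq_maxr ?size_polyD //.
by rewrite -big_split; apply: eq_bigr => j _; rewrite coefD raddfD /= mulrDl.
Qed.

Lemma normal_formZ p f : nu (p *: f) = phi p * nu f.
Proof.
rewrite (@normal_form_widen (size f)) ?size_scale_leq // /nu mulr_sumr.
by apply: eq_bigr => j _; rewrite coefZ rmorphM mulrA.
Qed.

Lemma normal_form0 : nu 0 = 0.
Proof. by rewrite /nu size_poly0 big_ord0. Qed.

Lemma normal_form1 : nu 1 = 1.
Proof. by rewrite /nu size_poly1 big_ord1 coef1 rmorph1 expr0 mulr1. Qed.

Let phiX : phi 'X = z.
Proof. by rewrite /= horner_algX. Qed.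

Let u_phi p : u * phi p = phi p * u + phi (jder p).
Proof.
elim/poly_ind: p => [|p c IH]; first by rewrite !raddf0 mulr0 mul0r addr0.
have phic : phi c%:P = c%:A by rewrite /= horner_algC.
rewrite !raddfD /= jderC raddf0 addr0 mulrDr mulrDl phic.
rewrite -scalerAr mulr1 -scalerAl mul1r addrAC; congr (_ + _).
have -> : phi (jder (p * 'X)) = phi p * (z * z) + phi (jder p) * z.
  by rewrite jderM jderX raddfD /= !rmorphM /= horner_algX.
rewrite rmorphM /= horner_algX mulrA IH.
by rewrite mulrDl -(mulrA _ u) uz mulrDr addrA mulrA.
Qed.

(** The subspace of normal forms is therefore stable under left multiplication by
    [u], and it is stable under [z] by construction. This is all of the
    multiplicative structure of normal forms that the spanning argument uses. *)
Lemma normal_form_uop f : nu (uop f) = u * nu f.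
Proof.
have sX : (size ('X * f)%R <= (size f).+1)%N.
  by rewrite (leq_trans (size_polyMleq _ _)) // size_polyX.
have sj : (size (map_poly (@jder k) f) <= size f)%N.
  by rewrite /map_poly size_poly.
rewrite /uop normal_formD (normal_form_widen sX) big_ord_recl coefXM.
rewrite raddf0 mul0r add0r (normal_form_widen sj) -big_split mulr_sumr.
apply: eq_bigr => j _.
by rewrite coef_map coefXM /= mulrA u_phi mulrDl exprS mulrA.
Qed.

(** With [J] the subalgebra generated by [z] and [u], these are the elements of
    [J + x y J], and of [x J + y J] when [odd] is true. *)
Definition parity_form (odd : bool) (b : A) := exists f l,
  b = if odd then x * nu f + y * nu l else nu f + x * y * nu l.

Lemma parity_form1 : parity_form false 1.
Proof. by exists 1, 0; rewrite normal_form1 normal_form0 mulr0 addr0. Qed.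

Lemma parity_formD i a b :
  parity_form i a -> parity_form i b -> parity_form i (a + b).
Proof.
move=> [f [l ->]] [f' [l' ->]]; exists (f + f'), (l + l').
by rewrite !normal_formD; case: i; rewrite !mulrDr addrACA.
Qed.

Lemma parity_formZ i c a : parity_form i a -> parity_form i (c *: a).
Proof.
move=> [f [l ->]]; exists (c%:P *: f), (c%:P *: l).
have e g : nu (c%:P *: g) = c *: nu g.
  by rewrite normal_formZ /= horner_algC -scalerAl mul1r.
by rewrite !e; case: i; rewrite -!scalerAr scalerDr.
Qed.

Lemma parity_formx i a : parity_form i a -> parity_form (~~ i) (x * a).
Proof.
move=> [f [l ->]]; case: i => /=.
  by exists 0, l; rewrite normal_form0 add0r mulrDr !mulrA xx mul0r add0r.
by exists f, 0; rewrite normal_form0 mulr0 addr0 mulrDr !mulrA xx !mul0r addr0.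
Qed.

Lemma parity_formy i a : parity_form i a -> parity_form (~~ i) (y * a).
Proof.
have nuX g : nu ('X *: g) = z * nu g by rewrite normal_formZ phiX.
move=> [f [l ->]]; case: i => /=.
  exists ('X *: f + uop l), (- f).
  have -> : nu (- f) = - nu f.
    by apply/eqP; rewrite -addr_eq0 -normal_formD addNr normal_form0.
  rewrite normal_formD nuX normal_form_uop mulrDr !mulrA -uE yx mulrBl mulrN.
  by rewrite addrAC.
exists (- ('X *: l + uop l)), (f + 'X *: l).
have -> : nu (- ('X *: l + uop l)) = - (z * nu l + u * nu l).
  apply/eqP; rewrite -addr_eq0 -nuX -normal_form_uop -!normal_formD addNr.
  by rewrite normal_form0.
rewrite normal_formD nuX mulrN [RHS]addrC !mulrDr -addrA; congr (_ + _).
rewrite !mulrA yx yz uE !(mulrDl, mulrBl) !mulrA.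
by rewrite opprD addrA addrK !mulNr.
Qed.

Section Action.
Local Notation V := (C * C)%type.
Variable act : V -> A -> V.
Hypothesis actD : forall v a b, act v (a + b) = act v a + act v b.
Hypothesis actM : forall v a b, act v (a * b) = act (act v b) a.
Hypothesis actZ1 : forall v c, act v c%:A = c%:P *: v.
Hypothesis actx : forall v, act v x = act_x v.
Hypothesis acty : forall v, act v y = act_y v.

Let act_phi p v : act v (phi p) = p *: v.
Proof.
elim/poly_ind: p v => [|p c IH] v.
  by rewrite raddf0 -(scale0r (1 : A)) actZ1 scale0r.
rewrite raddfD /= horner_algC actD actZ1 scalerDl; congr (_ + _).
rewrite -[LHS]/(act v (phi (p * 'X))) rmorphM /= horner_algX actM IH.
by rewrite zE (act_z actD actM actx acty) scalerA.
Qed.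

Let act_u f g j : act (f, g) (u ^+ j) = (iter j (@uop k) f, iter j (@uop k) g).
Proof.
elim: j => [|j IH]; first by rewrite expr0 -(scale1r 1) actZ1 scale1r.
by rewrite exprS actM IH uE actM !acty !act_yE.
Qed.

Lemma act_normal_form f g h : act (g, h) (nu f) = (star f g, star f h).
Proof.
have act0 v : act v 0 = 0.
  by have := actZ1 v 0; rewrite scale0r => ->; rewrite scale0r.
have sumE n (F G : 'I_n -> C) :
    \sum_i ((F i, G i) : V) = (\sum_i F i, \sum_i G i).
  by elim/big_rec3: _ => // i a b c _ ->; rewrite pair_addE.
rewrite /nu (big_morph _ (actD (g, h)) (act0 (g, h))) -sumE.
by apply: eq_bigr => j _; rewrite actM act_phi act_u pair_scaleE.
Qed.

(** Applying an even element to [1] in one of the two components recovers the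
    normal form of the element of the Jordan plane by which it acts there, because
    [star f 1 = f]. *)
Definition symbol1 b : C := (act (1, 0) b).1.
Definition symbol2 b : C := (act (0, 1) b).2.

Lemma act_even b f l g h : b = nu f + x * y * nu l ->
  act (g, h) b = (star (f + 'X *: l) g, star f h).
Proof.
move=> ->; rewrite actD !actM !act_normal_form acty actx act_yE act_xE.
by rewrite pair_addE addr0 starDl starZl.
Qed.

Lemma symbol1E b f l : b = nu f + x * y * nu l -> symbol1 b = f + 'X *: l.
Proof. by move=> /act_even e; rewrite /symbol1 e star1r. Qed.

Lemma symbol2E b f l : b = nu f + x * y * nu l -> symbol2 b = f.
Proof. by move=> /act_even e; rewrite /symbol2 e star1r. Qed.

Lemma act_symbols b g h : parity_form false b ->
  act (g, h) b = (star (symbol1 b) g, star (symbol2 b) h).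
Proof.
by move=> [f [l bE]]; rewrite (act_even _ _ bE) (symbol1E bE) (symbol2E bE).
Qed.

Lemma symbol1M a b : parity_form false a -> parity_form false b ->
  symbol1 (a * b) = star (symbol1 a) (symbol1 b).
Proof.
by move=> ea eb; rewrite {1}/symbol1 actM act_symbols // act_symbols // star1r.
Qed.

Lemma symbol2M a b : parity_form false a -> parity_form false b ->
  symbol2 (a * b) = star (symbol2 a) (symbol2 b).
Proof.
by move=> ea eb; rewrite {1}/symbol2 actM act_symbols // act_symbols // star1r.
Qed.

(** For [b = f + x y l] the symbols are [f + z l] and [f]; they determine [f] and [l],
    since multiplication by [z] is injective. Hence the spanning set of normal
    forms has no hidden relations among even elements. *)
Lemma symbols_inj b :
  parity_form false b -> symbol1 b = 0 -> symbol2 b = 0 -> b = 0.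
Proof.
move=> [f [l bE]]; rewrite (symbol1E bE) (symbol2E bE) bE => + f0.
rewrite f0 add0r => /eqP; rewrite -mul_polyC mulf_eq0 polyC_eq0 polyX_eq0 /= => /eqP->.
by rewrite normal_form0 mulr0 addr0.
Qed.

Lemma symbol1_normal f : symbol1 (nu f) = f.
Proof. by rewrite /symbol1 act_normal_form star1r. Qed.

Lemma symbol2_normal f : symbol2 (nu f) = f.
Proof. by rewrite /symbol2 act_normal_form star1r. Qed.

Lemma symbol1_xy : symbol1 (x * y) = 'X *: 1.
Proof. by rewrite /symbol1 actM acty actx. Qed.

Lemma symbol2_xy : symbol2 (x * y) = 0.
Proof. by rewrite /symbol2 actM acty actx. Qed.

Lemma symbol1_yx : symbol1 (y * x) = 0.
Proof. by rewrite /symbol1 actM acty actx /= raddf0. Qed.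

Lemma symbol2_yx : symbol2 (y * x) = 'X *: 1.
Proof. by rewrite /symbol2 actM acty actx. Qed.

End Action.
End Presentation.

(** * The even part of the super Jordan plane *)

Lemma sjp_relations_morph (A B : nzRingType) (f : {rmorphism A -> B}) x y r :
  sjp_relations (f x) (f y) r -> exists2 s, sjp_relations x y s & r = f s.
Proof.
case=> ->.
  by exists (x ^+ 2); [left | rewrite rmorphXn].
set z := x * y + y * x; exists (y * z - z * y - x * z); first by right.
by rewrite !(rmorphB, rmorphM, rmorphD).
Qed.

Section EvenPart.
Variable k : fieldType.
Local Notation C := {poly {poly k}}.
Local Notation V := (C * C)%type.
Local Notation free2 := {malg k[{fmonom 'I_2}]}.
Local Notation rels := (sjp_relations (free_x k) (free_y k)).
Local Notation proj := (alg_proj rels).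
Implicit Types (a b : sjp k) (v : V) (g h : free2).

Lemma sjp_actD v a b : sjp_act v (a + b) = sjp_act v a + sjp_act v b.
Proof.
elim/alg_mod_ind: a => g; elim/alg_mod_ind: b => h.
transitivity (sjp_act v (proj (g + h))); first by rewrite (alg_projD _ g h).
by rewrite !sjp_act_proj free_actD.
Qed.

Lemma sjp_actM v a b : sjp_act v (a * b) = sjp_act (sjp_act v b) a.
Proof.
elim/alg_mod_ind: a => g; elim/alg_mod_ind: b => h.
transitivity (sjp_act v (proj (g * h))); first by rewrite (alg_projM _ g h).
by rewrite !sjp_act_proj (free_actM v g h).
Qed.

Lemma sjp_act_scalar v (c : k) : sjp_act v (c%:A : sjp k) = c%:P *: v.
Proof.
transitivity (sjp_act v (proj (c *: 1))); first by rewrite (alg_projZ _ c 1).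
rewrite sjp_act_proj -mul_malgC mulr1 free_actU fm1.
by [].
Qed.

Definition sjp_x : sjp k := proj (free_x k).
Definition sjp_y : sjp k := proj (free_y k).

Lemma sjp_act_x v : sjp_act v sjp_x = act_x v.
Proof. by rewrite sjp_act_proj free_act_x. Qed.

Lemma sjp_act_y v : sjp_act v sjp_y = act_y v.
Proof. by rewrite sjp_act_proj free_act_y. Qed.

Lemma sjp_relations0 (r : sjp k) : sjp_relations sjp_x sjp_y r -> r = 0.
Proof.
move=> /(@sjp_relations_morph free2 (sjp k) proj)[s rs ->].
rewrite -(raddf0 proj); apply/alg_projP; rewrite subr0.
by apply/asboolP => I [_]; apply.
Qed.

Local Notation z := (sjp_x * sjp_y + sjp_y * sjp_x).
Local Notation u := (sjp_y * sjp_y).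

(** Reading a word from right to left, each letter switches between the even and the
    odd shape. *)
Lemma word_parity (s : seq 'I_2) :
  parity_form sjp_x sjp_y z u (odd (size s)) (proj << FMonom s >>).
Proof.
elim: s => [|i s IH] /=.
  rewrite -fmoneE; exact: parity_form1.
have -> : proj << FMonom (i :: s) >> =
    (proj << fmu i >> : sjp k) * proj << FMonom s >>.
  rewrite -[RHS]alg_projM malgM_def fgmulUU mulr1.
  by congr (proj << _ >>); apply: val_inj; rewrite /= fmM fmU.
have [->|->] : i = ord0 \/ i = ord_max.
  by case: i => [[|[|//]] lti]; [left | right]; apply: val_inj.
- exact: (parity_formx sjp_relations0 IH).
exact: (parity_formy _ _ sjp_relations0 IH).
Qed.

Local Notation even_form := (parity_form sjp_x sjp_y z u false).

Lemma sjp_homog_parity n (b : sjp k) :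
  sjp_homog n b -> parity_form sjp_x sjp_y z u (odd n) b.
Proof.
move=> [g hg ->] {b}; rewrite [g in proj g]monalgE raddf_sum big_seq /=.
apply: (big_ind (parity_form sjp_x sjp_y z u (odd n))).
- by have := parity_formZ 0 (word_parity (nseq n ord0)); rewrite size_nseq scale0r.
- by move=> a b; apply: parity_formD.
move=> m gm; rewrite -(hg m gm).
have -> : proj << g@_m *g m >> = g@_m *: (proj << m >> : sjp k).
  rewrite -[RHS](alg_projZ _ g@_m << m >>); congr (proj _).
  by rewrite -mul_malgC malgM_def fgmulUU mulr1 mul1m.
apply: parity_formZ; case: m {gm} => s; exact: word_parity.
Qed.

Lemma sjp_even_form (b : sjp0 k) : even_form (val b).
Proof.
case: b => b /= /asboolP [n [c [hc ->]]].
apply: (big_ind even_form) => [|a b'|i _].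
- by have := parity_formZ 0 (parity_form1 sjp_x sjp_y z u); rewrite scale0r.
- exact: parity_formD.
by have := sjp_homog_parity (hc i); rewrite odd_double.
Qed.

Lemma sjp_homog_x : sjp_homog 1 sjp_x.
Proof.
by exists (free_x k) => // w; rewrite msuppU1 inE => /eqP->; rewrite fdegU.
Qed.

Lemma sjp_homog_y : sjp_homog 1 sjp_y.
Proof.
by exists (free_y k) => // w; rewrite msuppU1 inE => /eqP->; rewrite fdegU.
Qed.

Lemma sjp_xy_even : sjp_x * sjp_y \in @sjp_even k.
Proof. exact: (@sjp_homog_even _ 1 _ (sjp_homogM sjp_homog_x sjp_homog_y)). Qed.

Lemma sjp_yx_even : sjp_y * sjp_x \in @sjp_even k.
Proof. exact: (@sjp_homog_even _ 1 _ (sjp_homogM sjp_homog_y sjp_homog_x)). Qed.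

Lemma sjp_yy_even : u \in @sjp_even k.
Proof. exact: (@sjp_homog_even _ 1 _ (sjp_homogM sjp_homog_y sjp_homog_y)). Qed.

Lemma normal_form_even f : normal_form z u f \in @sjp_even k.
Proof.
rewrite /normal_form; apply: rpred_sum => j _; apply: rpredM; last first.
  by apply: rpredX; exact: sjp_yy_even.
elim/poly_ind: (f`_j) => [|p c IH]; first by rewrite raddf0 rpred0.
rewrite raddfD /= rmorphM /= horner_algX horner_algC; apply: rpredD.
  exact: rpredM IH (rpredD sjp_xy_even sjp_yx_even).
exact: rpredZ (rpred1 _).
Qed.

Definition even_symbol1 (b : sjp0 k) : C := symbol1 (@sjp_act k) (val b).
Definition even_symbol2 (b : sjp0 k) : C := symbol2 (@sjp_act k) (val b).

Lemma sjp_actB v a b : sjp_act v (a - b) = sjp_act v a - sjp_act v b.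
Proof. by have := sjp_actD v (a - b) b; rewrite subrK => ->; rewrite addrK. Qed.

Fact even_symbol1_zmod_morphism : zmod_morphism even_symbol1.
Proof. by move=> a b; rewrite /even_symbol1 /symbol1 raddfB /= sjp_actB. Qed.
HB.instance Definition _ :=
  GRing.isZmodMorphism.Build (sjp0 k) C even_symbol1 even_symbol1_zmod_morphism.

Fact even_symbol2_zmod_morphism : zmod_morphism even_symbol2.
Proof. by move=> a b; rewrite /even_symbol2 /symbol2 raddfB /= sjp_actB. Qed.
HB.instance Definition _ :=
  GRing.isZmodMorphism.Build (sjp0 k) C even_symbol2 even_symbol2_zmod_morphism.

Lemma even_symbol1M (a b : sjp0 k) :
  even_symbol1 (a * b) = star (even_symbol1 a) (even_symbol1 b).
Proof.
rewrite /even_symbol1 (_ : val (a * b) = val a * val b) //.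
exact: (symbol1M erefl erefl sjp_actD sjp_actM sjp_act_scalar sjp_act_x
  sjp_act_y (sjp_even_form a) (sjp_even_form b)).
Qed.

Lemma even_symbol2M (a b : sjp0 k) :
  even_symbol2 (a * b) = star (even_symbol2 a) (even_symbol2 b).
Proof.
rewrite /even_symbol2 (_ : val (a * b) = val a * val b) //.
exact: (symbol2M erefl erefl sjp_actD sjp_actM sjp_act_scalar sjp_act_x
  sjp_act_y (sjp_even_form a) (sjp_even_form b)).
Qed.

Lemma even_symbol1_surj f : exists b : sjp0 k, even_symbol1 b = f.
Proof.
exists (Sjp0 (normal_form_even f)).
exact: (symbol1_normal erefl erefl sjp_actD sjp_actM sjp_act_scalar sjp_act_x
  sjp_act_y).
Qed.

Lemma even_symbol2_surj f : exists b : sjp0 k, even_symbol2 b = f.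
Proof.
exists (Sjp0 (normal_form_even f)).
exact: (symbol2_normal erefl erefl sjp_actD sjp_actM sjp_act_scalar sjp_act_x
  sjp_act_y).
Qed.

Lemma even_symbols_inj (b : sjp0 k) :
  even_symbol1 b = 0 -> even_symbol2 b = 0 -> b = 0.
Proof.
move=> b1 b2; apply: val_inj; rewrite raddf0.
exact: (symbols_inj erefl erefl sjp_actD sjp_actM sjp_act_scalar sjp_act_x
  sjp_act_y (sjp_even_form b) b1 b2).
Qed.

(** [x y] is supported on the first factor and [y x] on the second one. *)
Lemma sjp0_two_primes : two_primes (symbol_ker even_symbol1)
  (symbol_ker even_symbol2) (Sjp0 sjp_xy_even) (Sjp0 sjp_yx_even).
Proof.
have X0 : 'X *: 1 <> 0 :> C.
  by apply/eqP; rewrite -mul_polyC mulr1 polyC_eq0 polyX_eq0.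
split.
- exact: symbol_ker_ideal even_symbol1M.
- exact: symbol_ker_ideal even_symbol2M.
- exact: symbol_ker_prime even_symbol1M.
- exact: symbol_ker_prime even_symbol2M.
- exact: even_symbols_inj.
- split; first exact: (symbol2_xy sjp_actM sjp_act_x sjp_act_y).
  rewrite /symbol_ker /= [even_symbol1 _](symbol1_xy sjp_actM sjp_act_x sjp_act_y).
  exact: X0.
split; first exact: (symbol1_yx sjp_actM sjp_act_x sjp_act_y).
rewrite /symbol_ker /= [even_symbol2 _](symbol2_yx sjp_actM sjp_act_x sjp_act_y).
exact: X0.
Qed.

End EvenPart.

Theorem theorem4p4 (k : fieldType) (k_char : 2%N \notin [pchar k]) :
  [/\ right_Ore (@regular_elements (sjp0 k)),
      left_Ore (@regular_elements (sjp0 k)),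
      exists (Q : nzRingType) (f : {rmorphism sjp0 k -> Q}),
        is_total_fractions f
    & forall (Q : nzRingType) (f : {rmorphism sjp0 k -> Q}),
        is_total_fractions f -> semisimple_artinian Q].
Proof.
have tp := sjp0_two_primes k.
have RO : right_Ore (@regular_elements (sjp0 k)).
  apply: (two_primes_right_Ore tp).
    exact: symbol_right_Ore (@even_symbol1M k) (@even_symbol1_surj k).
  exact: symbol_right_Ore (@even_symbol2M k) (@even_symbol2_surj k).
have LO : left_Ore (@regular_elements (sjp0 k)).
  apply: (two_primes_left_Ore tp).
    exact: symbol_left_Ore (@even_symbol1M k) (@even_symbol1_surj k).
  exact: symbol_left_Ore (@even_symbol2M k) (@even_symbol2_surj k).
split=> //; first exact: Ore_total_fractions.
by move=> Q f; exact: two_primes_semisimple_artinian tp RO LO.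
Qed.
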